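(* We have $$\dim_{\bar S}Z(\Lambda/\operatorname{Jac}(\Lambda))\;=\;\dim_{\bar S}Z(\bar\Lambda/\operatorname{Jac}(\bar\Lambda))\;=\;\sum_{\sigma\in\operatorname{Cl}_{p'}(G)}\dim_{\bar S}(\bar T_0/V_\sigma).$$
   Context: A finite group $G$ acts (from the right, $y\mapsto y^\sigma$, by field automorphisms, not necessarily faithfully) on a field $L$ with fixed field $K$. (No condition on the characteristic of $L$ is imposed.) Let $S\subset K$ be a discrete valuation ring with field of fractions $K$, maximal ideal generated by $\pi$, and residue field $\bar S=S/\pi S$, which is assumed to be finite, of characteristic $p$. Let $T$ be the integral closure of $S$ in $L$; it is $G$-stable. Let $\bar T=T/\pi T$ and $\bar T_0=\bar T/\operatorname{Jac}(\bar T)=T/\operatorname{Jac}(T)$, both with the induced $G$-operation. For a commutative ring $C$ with (right) $G$-operation, the twisted group ring $C\wr G$ is the free right $C$-module on $G$ with multiplication determined by $(\sigma y)(\tau z)=(\sigma\tau)(y^\tau z)$ for $\sigma,\tau\in G$, $y,z\in C$. Put $\Lambda=T\wr G$ and $\bar\Lambda=\bar T\wr G$. $\operatorname{Jac}$ denotes the Jacobson radical and $Z$ the center. For $\sigma\in G$ let $V_\sigma\subset\bar T_0$ be the $\bar S$-linear span of all elements $(y^\sigma-y)z$ and $y^\rho-y$, with $y,z\in\bar T_0$ and $\rho\in C_G(\sigma)$, the centralizer of $\sigma$. Let $\operatorname{Cl}_{p'}(G)$ be a set of representatives of the conjugacy classes of elements of $G$ of order not divisible by $p$. *)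

(* Defs.v *)
From HB Require Import structures.
From mathcomp Require Import all_boot all_order all_algebra all_fingroup.
From mathcomp Require Import boolp classical_sets functions cardinality.

Set Implicit Arguments.
Unset Strict Implicit.
Unset Printing Implicit Defensive.

Import GRing.Theory.
Local Open Scope ring_scope.
Local Open Scope quotient_scope.

Definition left_ideal (R : pzRingType) (I : set R) : Prop :=
  [/\ I 0, forall x y, I x -> I y -> I (x - y) & forall a x, I x -> I (a * x)].

Definition maximal_left_ideal (R : pzRingType) (M : set R) : Prop :=
  [/\ left_ideal M, ~ M 1 &
      forall N : set R, left_ideal N -> (M `<=` N)%classic -> ~ N 1 -> N = M].

Record twosided (R : pzRingType) := TwoSided {
  ideal_set :> R -> Prop;
  ideal_left : left_ideal ideal_set;
  ideal_right : forall a x, ideal_set x -> ideal_set (x * a) }.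

Section QuotientRing.
Variables (R : pzRingType) (I : twosided R).

Definition ideal_pred : {pred R} := fun x => `[< I x >].

Lemma ideal_predP x : reflect (I x) (x \in ideal_pred).
Proof. exact: asboolP. Qed.

Lemma ideal_zmod_closed : zmod_closed ideal_pred.
Proof.
have [I0 IB _] := ideal_left I.
split=> [|x y /ideal_predP Ix /ideal_predP Iy]; apply/ideal_predP => //.
exact: IB.
Qed.
HB.instance Definition _ := GRing.isZmodClosed.Build R ideal_pred ideal_zmod_closed.

(* The additive quotient is the library's [{quot _}], which carries a
   multiplication only for proper ideals of commutative nonzero rings. *)
Definition quot_ring : Type := Quotient.quot ideal_pred.
HB.instance Definition _ := GRing.Zmodule.on quot_ring.

Definition quot_proj (x : R) : quot_ring := \pi_(Quotient.quot ideal_pred) x.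
Definition quot_repr (u : quot_ring) : R := generic_quotient.repr (u : Quotient.quot ideal_pred).

Lemma quot_reprK : cancel quot_repr quot_proj.
Proof. exact: reprK. Qed.

Lemma quot_projP x y : quot_proj x = quot_proj y <-> I (x - y).
Proof.
rewrite /quot_proj; split=> [/eqP | Ixy].
  by rewrite -Quotient.idealrBE => /ideal_predP.
by apply/eqP; rewrite -Quotient.idealrBE; apply/ideal_predP.
Qed.

Lemma quot_proj_repr x : I (quot_repr (quot_proj x) - x).
Proof. by apply/quot_projP; rewrite quot_reprK. Qed.

Lemma quot_proj_zmod : zmod_morphism quot_proj.
Proof. by move=> x y; rewrite /quot_proj !raddfB. Qed.

Definition quot_mul (u v : quot_ring) : quot_ring :=
  quot_proj (quot_repr u * quot_repr v).

Lemma quot_mulE x y : quot_mul (quot_proj x) (quot_proj y) = quot_proj (x * y).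
Proof.
have [I0 IB IM] := ideal_left I; apply/quot_projP.
set x' := quot_repr _; set y' := quot_repr _.
have -> : x' * y' - x * y = (x' - x) * y' - x * (y - y').
  by rewrite mulrBl mulrBr opprB addrA subrK.
apply: (IB); first exact/ideal_right/quot_proj_repr.
by apply: IM; rewrite -opprB -sub0r; apply: IB => //; apply: quot_proj_repr.
Qed.

Lemma quot_ind (P : quot_ring -> Prop) : (forall x, P (quot_proj x)) -> forall u, P u.
Proof. by move=> PP u; rewrite -(quot_reprK u). Qed.

Lemma quot_projD x y : quot_proj (x + y) = quot_proj x + quot_proj y.
Proof. by rewrite /quot_proj raddfD. Qed.

Lemma quot_mulA : associative quot_mul.
Proof.
by elim/quot_ind=> x; elim/quot_ind=> y; elim/quot_ind=> z; rewrite !quot_mulE mulrA.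
Qed.
Lemma quot_mul1 : left_id (quot_proj 1) quot_mul.
Proof. by elim/quot_ind=> x; rewrite quot_mulE mul1r. Qed.
Lemma quot_mulr1 : right_id (quot_proj 1) quot_mul.
Proof. by elim/quot_ind=> x; rewrite quot_mulE mulr1. Qed.
Lemma quot_mulDl : left_distributive quot_mul +%R.
Proof.
by elim/quot_ind=> x; elim/quot_ind=> y; elim/quot_ind=> z;
  rewrite -quot_projD !quot_mulE mulrDl quot_projD.
Qed.
Lemma quot_mulDr : right_distributive quot_mul +%R.
Proof.
by elim/quot_ind=> x; elim/quot_ind=> y; elim/quot_ind=> z;
  rewrite -quot_projD !quot_mulE mulrDr quot_projD.
Qed.
HB.instance Definition _ := GRing.Zmodule_isPzRing.Build quot_ring
  quot_mulA quot_mul1 quot_mulr1 quot_mulDl quot_mulDr.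

Lemma quot_proj_monoid : monoid_morphism quot_proj.
Proof. by split=> // x y; rewrite -quot_mulE. Qed.

HB.instance Definition _ := GRing.isZmodMorphism.Build R quot_ring quot_proj quot_proj_zmod.
HB.instance Definition _ := GRing.isMonoidMorphism.Build R quot_ring quot_proj quot_proj_monoid.

End QuotientRing.

Section ComQuotient.
Variables (R : comPzRingType) (I : twosided R).
Lemma quot_mulC : @commutative (quot_ring I) _ *%R.
Proof.
by elim/quot_ind=> x; elim/quot_ind=> y; rewrite -!rmorphM mulrC.
Qed.
HB.instance Definition _ := GRing.PzRing_hasCommutativeMul.Build (quot_ring I) quot_mulC.

Section Principal.
Variable a : R.
Definition multiples : set R := [set x | exists b, x = b * a]%classic.

Lemma multiples_left_ideal : left_ideal multiples.
Proof.
split=> [|x y [b ->] [c ->]|b x [c ->]]; first by exists 0; rewrite mul0r.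
  by exists (b - c); rewrite mulrBl.
by exists (b * c); rewrite mulrA.
Qed.

Lemma multiples_right b x : multiples x -> multiples (x * b).
Proof. by case=> c ->; exists (c * b); rewrite mulrAC. Qed.

Definition principal_ideal := TwoSided multiples_left_ideal multiples_right.
End Principal.
End ComQuotient.

Section Jacobson.
Variable R : pzRingType.

Definition jac_set : set R :=
  [set x | forall M : set R, maximal_left_ideal M -> M x]%classic.

Lemma jac_left : left_ideal jac_set.
Proof.
split=> [|x y Jx Jy|a x Jx] M maxM; have [[M0 MB MM] _ _] := maxM => //.
  by apply: MB; [apply: Jx | apply: Jy].
by apply: MM; apply: Jx.
Qed.

Lemma jac_right a x : jac_set x -> jac_set (x * a).
Proof.
move=> Jx M maxM; have [[M0 MB MM] M1 Mmax] := maxM.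
case: (pselect (M a)) => [Ma | nMa]; first exact: MM.
suff /Jx : maximal_left_ideal (fun y => M (y * a)) by [].
have MD u v : M u -> M v -> M (u + v).
  by move=> Mu Mv; rewrite -[v]opprK; apply: (MB) => //; rewrite -sub0r; apply: MB.
split=> [||N [N0 NB NM] sMN N1]; last 1 first.
- apply/seteqP; split=> [n Nn|]; last exact: sMN.
  apply: contrapT => nMn; apply: N1.
  pose M' : set R := [set u | exists m b, M m /\ u = m + b * (n * a)]%classic.
  have M'lid : left_ideal M'.
    split=> [|u v [m [b [Mm ->]]] [m' [b' [Mm' ->]]]|c u [m [b [Mm ->]]]].
    - by exists 0, 0; rewrite mul0r addr0.
    - exists (m - m'), (b - b'); split; first exact: MB.
      by rewrite mulrBl opprD addrACA.
    - by exists (c * m), (c * b); rewrite mulrDr mulrA; split=> //; apply: MM.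
  have sMM' : (M `<=` M')%classic.
    by move=> m Mm; exists m, 0; rewrite mul0r addr0.
  have M'1 : M' 1.
    apply: contrapT => nM'1; apply: nMn.
    rewrite -(Mmax M' M'lid sMM' nM'1); exists 0, 1.
    by rewrite mul1r add0r.
  have [m [b [Mm def1]]] := M'1.
  have Nd : N (1 - a * b * n).
    apply: sMN; rewrite mulrBl mul1r.
    have -> : a - a * b * n * a = a * m.
      by rewrite -{1}[a]mulr1 def1 mulrDr !mulrA addrK.
    exact: MM.
  have Nabn : N (0 - a * b * n) by apply: (NB) => //; apply: NM.
  by have := NB _ _ Nd Nabn; rewrite sub0r opprK subrK.
- split=> [|y z My Mz|b y My]; rewrite ?mul0r // ?mulrBl -?mulrA.
    exact: MB.
  exact: MM.
- by rewrite mul1r.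
Qed.

Definition Jac : twosided R := TwoSided jac_left jac_right.

Definition center : set R := [set x | forall y, x * y = y * x]%classic.

End Jacobson.

Arguments center R : clear implicits.

Definition is_dvr (S : comPzRingType) (w : S) : Prop :=
  [/\ (1 : S) != 0,
      forall x y : S, x * y = 0 -> x = 0 \/ y = 0,
      forall I : set S, left_ideal I -> exists a, I = multiples a,
      w != 0 &
      forall M : set S, maximal_left_ideal M <-> M = multiples w].

(* Span over S, equivalently over any quotient of S through which f factors. *)
Definition lin_span (S : comPzRingType) (A : pzRingType) (f : {rmorphism S -> A})
    (X : set A) : set A :=
  [set v | exists (n : nat) (a : 'I_n -> S) (x : 'I_n -> A),
     (forall i, X (x i)) /\ v = \sum_i f (a i) * x i]%classic.

(* [residue_dim f w U W n]: the ring A is an S-module through f, and for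
   W <= U <= A the S-module U / W is a vector space of dimension n over S / wS.
   The S / wS-linear combinations of the e i in U / W are the classes of the
   S-linear ones; taking a i = w in the last clause shows that w annihilates
   U / W, so this never holds if U / W is not a vector space over S / wS. *)
Definition residue_dim (S : comPzRingType) (A : pzRingType) (f : {rmorphism S -> A})
    (w : S) (U W : set A) (n : nat) : Prop :=
  exists e : 'I_n -> A,
    [/\ forall i, U (e i),
        forall x, U x -> exists a : 'I_n -> S, W (x - \sum_i f (a i) * e i)
      & forall a : 'I_n -> S,
          W (\sum_i f (a i) * e i) <-> forall i, multiples w (a i)].

(* The library's [{action gT &-> C}] is developed only for finite C. *)
Record ringAction (gT : finGroupType) (C : pzRingType) := RingAction {
  ract :> C -> gT -> C;
  ract1 : forall x, ract x 1%g = x;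
  ractM : forall x s t, ract x (s * t)%g = ract (ract x s) t;
  ract_zmod : forall s, zmod_morphism (ract^~ s);
  ract_monoid : forall s, monoid_morphism (ract^~ s) }.

Section RingActionTheory.
Variables (gT : finGroupType) (C : pzRingType) (act : ringAction gT C).

Lemma ractB x y s : act (x - y) s = act x s - act y s.
Proof. exact: ract_zmod. Qed.
Lemma ract0 s : act 0 s = 0.
Proof. by rewrite -[X in act X](subrr 0) ractB subrr. Qed.
Lemma ractN x s : act (- x) s = - act x s.
Proof. by rewrite -sub0r ractB ract0 sub0r. Qed.
Lemma ractD x y s : act (x + y) s = act x s + act y s.
Proof. by rewrite -[y in LHS]opprK ractB ractN opprK. Qed.
Lemma ract1r s : act 1 s = 1.
Proof. exact: (ract_monoid act s).1. Qed.
Lemma ractMr x y s : act (x * y) s = act x s * act y s.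
Proof. exact: (ract_monoid act s).2. Qed.
Lemma ractX x n s : act (x ^+ n) s = act x s ^+ n.
Proof. by elim: n => [|n IHn]; rewrite ?ract1r // !exprS ractMr IHn. Qed.
Lemma ract_sum (I : finType) (F : I -> C) s :
  act (\sum_i F i) s = \sum_i act (F i) s.
Proof. by elim/big_rec2: _ => [|i y x _ <-]; rewrite ?ract0 ?ractD. Qed.

Lemma ractK s : cancel (act^~ s) (act^~ s^-1%g).
Proof. by move=> x /=; rewrite -ractM mulgV ract1. Qed.
Lemma ractKV s : cancel (act^~ s^-1%g) (act^~ s).
Proof. by move=> x /=; rewrite -ractM mulVg ract1. Qed.

Definition fixed_by : set C := [set x | forall s, act x s = x]%classic.

Section Quot.
Variables (I : twosided C) (Istab : forall x s, I x -> I (act x s)).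

Definition quot_act_fun (u : quot_ring I) s := quot_proj I (act (quot_repr u) s).

Lemma quot_act_funE x s : quot_act_fun (quot_proj I x) s = quot_proj I (act x s).
Proof. by apply/quot_projP; rewrite -ractB; apply/Istab/quot_proj_repr. Qed.

Lemma quot_act1 : forall u, quot_act_fun u 1%g = u.
Proof. by elim/quot_ind=> x; rewrite quot_act_funE ract1. Qed.
Lemma quot_actM : forall u s t, quot_act_fun u (s * t)%g = quot_act_fun (quot_act_fun u s) t.
Proof. by elim/quot_ind=> x s t; rewrite !quot_act_funE ractM. Qed.
Lemma quot_act_zmod s : zmod_morphism (quot_act_fun^~ s).
Proof.
by elim/quot_ind=> x; elim/quot_ind=> y; rewrite -rmorphB !quot_act_funE ractB rmorphB.
Qed.
Lemma quot_act_monoid s : monoid_morphism (quot_act_fun^~ s).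
Proof.
split=> [|]; first by rewrite -[1](rmorph1 (quot_proj I)) quot_act_funE ract1r.
by elim/quot_ind=> x; elim/quot_ind=> y; rewrite -rmorphM !quot_act_funE ractMr rmorphM.
Qed.

Definition quot_act : ringAction gT (quot_ring I) :=
  @RingAction _ _ _ quot_act1 quot_actM quot_act_zmod quot_act_monoid.
End Quot.

Lemma maximal_left_ideal_ract (M : set C) s :
  maximal_left_ideal M -> maximal_left_ideal (fun x => M (act x s)).
Proof.
have lid (N : set C) t : left_ideal N -> left_ideal (fun x => N (act x t)).
  move=> [N0 NB NM]; split=> [|x y Nx Ny|a x Nx]; rewrite ?ract0 ?ractB ?ractMr //.
    exact: NB.
  exact: NM.
move=> [Ml M1 Mmax]; split; [exact: lid | by rewrite ract1r |].
move=> N Nl sMN N1; apply/seteqP; split=> [x Nx|]; last exact: sMN.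
rewrite -(Mmax (fun x => N (act x s^-1%g))) ?ractK //; first exact: lid.
  by move=> y My; apply: sMN; rewrite ractKV.
by rewrite ract1r.
Qed.

Lemma Jac_stable x s : Jac C x -> Jac C (act x s).
Proof. by move=> Jx M /(maximal_left_ideal_ract s); apply: Jx. Qed.

Definition Jac_quot_act : ringAction gT (quot_ring (Jac C)) := quot_act Jac_stable.

End RingActionTheory.

Lemma multiples_stable (gT : finGroupType) (C : comPzRingType)
    (act : ringAction gT C) (a : C) :
  fixed_by act a -> forall x s, principal_ideal a x -> principal_ideal a (act x s).
Proof. by move=> fa x s [b ->]; exists (act b s); rewrite ractMr fa. Qed.

(* The finite function u stands for the sum over s of s * (u s); the action is a
   parameter of the type because the multiplication depends on it. *)
Definition twisted (gT : finGroupType) (C : comPzRingType)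
  (act : ringAction gT C) : Type := {ffun gT -> C}.

Section TwistedGroupRing.
Variables (gT : finGroupType) (C : comPzRingType) (act : ringAction gT C).
Local Notation twisted := (twisted act).
HB.instance Definition _ := GRing.Zmodule.on twisted.

Definition tw_elt (s : gT) (y : C) : twisted := [ffun t => if t == s then y else 0].

Definition tw_mul (u v : twisted) : twisted :=
  [ffun r => \sum_t act (u (r * t^-1)%g) t * v t].

Lemma tw_mul_elt s t y z : tw_mul (tw_elt s y) (tw_elt t z) = tw_elt (s * t)%g (act y t * z).
Proof.
apply/ffunP=> r; rewrite !ffunE (bigD1 t) //= big1 ?addr0; last first.
  by move=> i /negPf it; rewrite !ffunE it mulr0.
rewrite !ffunE eqxx (can2_eq (mulgKV t) (mulgK t)).
by case: eqP; rewrite ?ract0 ?mul0r.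
Qed.

Lemma tw_mulA : associative tw_mul.
Proof.
move=> u v x; apply/ffunP=> r; rewrite !ffunE.
under eq_bigr do rewrite ffunE mulr_sumr.
under [RHS]eq_bigr do rewrite ffunE ract_sum mulr_suml.
rewrite exchange_big; apply: eq_bigr => t _ /=.
rewrite (reindex_inj (mulIg t)); apply: eq_bigr => s _ /=.
by rewrite ractMr -ractM mulrA mulgK invMg mulgA.
Qed.
Lemma tw_mul1 : left_id (tw_elt 1%g 1) tw_mul.
Proof.
move=> u; apply/ffunP=> r; rewrite !ffunE (bigD1 r) //= big1 ?addr0.
  by rewrite ffunE mulgV eqxx ract1r mul1r.
move=> t tr; rewrite ffunE -eq_mulgV1 eq_sym (negPf tr) ract0 mul0r //.
Qed.
Lemma tw_mulr1 : right_id (tw_elt 1%g 1) tw_mul.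
Proof.
move=> u; apply/ffunP=> r; rewrite !ffunE (bigD1 1%g) //= big1 ?addr0.
  by rewrite ffunE eqxx invg1 mulg1 ract1 mulr1.
by move=> t /negPf t1; rewrite !ffunE t1 mulr0.
Qed.
Lemma tw_mulDl : left_distributive tw_mul +%R.
Proof.
move=> u v x; apply/ffunP=> r; rewrite !ffunE -big_split.
by apply: eq_bigr => t _; rewrite ffunE ractD mulrDl.
Qed.
Lemma tw_mulDr : right_distributive tw_mul +%R.
Proof.
move=> u v x; apply/ffunP=> r; rewrite !ffunE -big_split.
by apply: eq_bigr => t _; rewrite ffunE mulrDr.
Qed.
HB.instance Definition _ := GRing.Zmodule_isPzRing.Build twisted
  tw_mulA tw_mul1 tw_mulr1 tw_mulDl tw_mulDr.

Definition tw_coef (y : C) : twisted := tw_elt 1%g y.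
Lemma tw_coef_zmod : zmod_morphism tw_coef.
Proof. by move=> x y; apply/ffunP=> r; rewrite !ffunE; case: eqP; rewrite ?subrr. Qed.
Lemma tw_coef_monoid : monoid_morphism tw_coef.
Proof. by split=> // x y; rewrite [RHS]tw_mul_elt mulg1 ract1. Qed.
HB.instance Definition _ := GRing.isZmodMorphism.Build C twisted tw_coef tw_coef_zmod.
HB.instance Definition _ := GRing.isMonoidMorphism.Build C twisted tw_coef tw_coef_monoid.

End TwistedGroupRing.

Section SubRing.
Variables (L : fieldType) (S : subringClosed L).
Definition sub_ring : Type := {x : L | x \in S}.
HB.instance Definition _ := SubChoice.on sub_ring.
HB.instance Definition _ := [SubChoice_isSubComNzRing of sub_ring by <:].
End SubRing.

Section IntegralClosure.
Variables (gT : finGroupType) (L : fieldType) (act : ringAction gT L).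
Variable S : subringClosed L.

Definition int_closure : {pred L} :=
  fun x => `[< integralOver (val : sub_ring S -> L) x >].

Lemma int_closureP x :
  reflect (integralOver (val : sub_ring S -> L) x) (x \in int_closure).
Proof. exact: asboolP. Qed.

Lemma int_closure_subring : subring_closed int_closure.
Proof.
split=> [|x y /int_closureP Tx /int_closureP Ty|x y /int_closureP Tx /int_closureP Ty];
  apply/int_closureP.
- exact: integral1.
- exact: integral_sub.
- exact: integral_mul.
Qed.
HB.instance Definition _ :=
  GRing.isSubringClosed.Build L int_closure int_closure_subring.

Definition intT : Type := sub_ring int_closure.
HB.instance Definition _ := GRing.SubComNzRing.on intT.

Lemma base_in_closure (a : sub_ring S) : val a \in int_closure.
Proof. exact/int_closureP/integral_id. Qed.

Definition base_to_T (a : sub_ring S) : intT := Sub (val a) (base_in_closure a).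
Lemma base_to_T_zmod : zmod_morphism base_to_T.
Proof. by move=> a b; apply: val_inj; rewrite /=. Qed.
Lemma base_to_T_monoid : monoid_morphism base_to_T.
Proof. by split=> [|a b]; apply: val_inj; rewrite /= ?rmorph1 ?rmorphM. Qed.
HB.instance Definition _ :=
  GRing.isZmodMorphism.Build (sub_ring S) intT base_to_T base_to_T_zmod.
HB.instance Definition _ :=
  GRing.isMonoidMorphism.Build (sub_ring S) intT base_to_T base_to_T_monoid.

(* S lies in the fixed field; this is what makes its integral closure stable. *)
Hypothesis hSK : forall x, x \in S -> fixed_by act x.

Lemma int_closure_stable x s : x \in int_closure -> act x s \in int_closure.
Proof.
case/int_closureP=> p mon_p /rootP px0; apply/int_closureP; exists p => //.
apply/rootP; move/(congr1 (act^~ s)): px0.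
rewrite ract0 => pxs0; rewrite -[RHS]pxs0 !horner_coef ract_sum.
apply: eq_bigr => i _; rewrite ractMr ractX coef_map /=.
by rewrite (hSK (valP p`_i)).
Qed.

Definition actT_fun (x : intT) s : intT :=
  Sub (act (val x) s) (int_closure_stable s (valP x)).
Lemma actT1 : forall x, actT_fun x 1%g = x.
Proof. by move=> x; apply: val_inj; rewrite /= ract1. Qed.
Lemma actT_M : forall x s t, actT_fun x (s * t)%g = actT_fun (actT_fun x s) t.
Proof. by move=> x s t; apply: val_inj; rewrite /= ractM. Qed.
Lemma actT_zmod s : zmod_morphism (actT_fun^~ s).
Proof. by move=> x y; apply: val_inj; rewrite /= ractB. Qed.
Lemma actT_monoid s : monoid_morphism (actT_fun^~ s).
Proof.
by split=> [|x y]; apply: val_inj; rewrite /= ?ract1r ?ractMr.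
Qed.
Definition actT : ringAction gT intT :=
  @RingAction _ _ _ actT1 actT_M actT_zmod actT_monoid.

Lemma base_to_T_fixed a : fixed_by actT (base_to_T a).
Proof. by move=> s; apply: val_inj; rewrite /= hSK ?(valP a). Qed.

Variable w : sub_ring S.

Definition Sbar : comPzRingType := quot_ring (principal_ideal w).

Definition Tbar : comPzRingType := quot_ring (principal_ideal (base_to_T w)).
Definition actTbar : ringAction gT Tbar :=
  quot_act (multiples_stable (base_to_T_fixed w)).
Definition base_to_Tbar : {rmorphism sub_ring S -> Tbar} :=
  quot_proj (principal_ideal (base_to_T w)) \o base_to_T.

Definition Tbar0 : comPzRingType := quot_ring (Jac Tbar).
Definition actTbar0 : ringAction gT Tbar0 := Jac_quot_act actTbar.
Definition base_to_Tbar0 : {rmorphism sub_ring S -> Tbar0} :=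
  quot_proj (Jac Tbar) \o base_to_Tbar.

Definition Lam : pzRingType := twisted actT.
Definition LamJ : pzRingType := quot_ring (Jac Lam).
Definition base_to_LamJ : {rmorphism sub_ring S -> LamJ} :=
  quot_proj (Jac Lam) \o (tw_coef actT \o base_to_T).

Definition Lambar : pzRingType := twisted actTbar.
Definition LambarJ : pzRingType := quot_ring (Jac Lambar).
Definition base_to_LambarJ : {rmorphism sub_ring S -> LambarJ} :=
  quot_proj (Jac Lambar) \o (tw_coef actTbar \o base_to_Tbar).

Definition V_gens (s : gT) : set Tbar0 :=
  [set v | (exists y z : Tbar0, v = (actTbar0 y s - y) * z) \/
           (exists (r : gT) (y : Tbar0), r \in 'C[s]%g /\ v = actTbar0 y r - y)]%classic.

Definition V_space (s : gT) : set Tbar0 := lin_span base_to_Tbar0 (V_gens s).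

End IntegralClosure.

Arguments V_space {gT L act S} hSK w s.

Definition p_regular (gT : finGroupType) (p : nat) : {set gT} :=
  [set x | ~~ (p %| #[x]%g)%N]%SET.

Definition p_regular_reps (gT : finGroupType) (p : nat) (Cl : {set gT}) : bool :=
  is_transversal Cl [set (x ^: [set: gT])%g | x in p_regular gT p]%SET (p_regular gT p).

(* Main.v *)
(* Let F = S/wS, q = #|F|, and let A be a finite F-algebra of the form C wr G.
   Write [A, A] for the span of the commutators and T(A) for the set of x such that
   x^(q^n) lies in [A, A] for some n; since x -> x^q is additive modulo [A, A],
   T(A) is a subspace.

   Some linear form lam on A satisfies lam(xy) = lam(yx) and lam(x^q) = lam(x), and
   has radical Jac A: it is a sum of traces of irreducible matrix representations
   over F.  For such a form the elements central modulo Jac A are exactly the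
   orthogonal of T(A), so Z(A / Jac A) is dual to A / T(A).

   On A / T(A) the map x -> x^q is injective, hence bijective; as it sends s y to an
   element s^q y', iterating it shows that A / T(A) is spanned by the s y with s
   p-regular.  Modulo T(A), s y only depends on the class of y in Tbar0 / V_s and on
   the conjugacy class of s, and there is no other relation because x -> x^q is
   injective on Tbar0 / V_s.

   Finally T/wT is finite by Artin's bound on linearly independent elements over the
   fixed field, and w lies in every maximal left ideal of T wr G, so that T wr G and
   (T/wT) wr G have the same quotient by the radical. *)

From HB Require Import structures.
From mathcomp Require Import all_boot all_order all_algebra all_fingroup.
From mathcomp Require Import all_solvable all_field.
From mathcomp Require Import boolp classical_sets functions cardinality.
Require Import Defs.

Set Implicit Arguments.
Unset Strict Implicit.
Unset Printing Implicit Defensive.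

Import GRing.Theory.
Local Open Scope ring_scope.

(** * Powers modulo commutators *)

(** The field F need not split A / Jac A. Over a splitting field a trace would only satisfy lam(x^q)
    = lam(x)^q; traces over F itself take values fixed by the q-th power, and this is what makes lam
    vanish on T(A). The price is that the trace of an irreducible representation has to be shown
    nonzero even if its endomorphism ring is larger than F. For this an element of minimal rank in
    an ideal cuts out a finite division ring of matrices, commutative by Wedderburn's little
    theorem, in which a counting argument finds a nonzero trace. The form is built greedily: as long
    as its radical contains an element that generates a non-nil left ideal, the trace of a further
    irreducible representation is added, and the radical, a finite set, shrinks strictly.

    The detour through A / T(A) pays because this quotient splits along conjugacy classes of group
    elements, where explicit bases can be written down; the center of A / Jac A has no such visible
    decomposition. *)

Section Commutators.
Variable A : pzRingType.
Implicit Types x y z : A.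

(** Plain sums suffice for [A, A]: a central scalar is absorbed into the first factor of each
    commutator ([commsumZ]), so this is already a subspace over any central field. *)
Definition commsum x : Prop :=
  exists s : seq (A * A), x = \sum_(u <- s) (u.1 * u.2 - u.2 * u.1).

Lemma commsum0 : commsum 0.
Proof. by exists [::]; rewrite big_nil. Qed.

Lemma commsumD x y : commsum x -> commsum y -> commsum (x + y).
Proof. by move=> [s ->] [t ->]; exists (s ++ t); rewrite big_cat. Qed.

Lemma commsumN x : commsum x -> commsum (- x).
Proof.
move=> [s ->]; exists [seq (u.2, u.1) | u <- s].
by rewrite big_map /= -sumrN; apply: eq_bigr => u _; rewrite opprB.
Qed.

Lemma commsumB x y : commsum x -> commsum y -> commsum (x - y).
Proof. by move=> cx cy; apply/commsumD/commsumN. Qed.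

Lemma commsum_trans y x z : commsum (x - y) -> commsum (y - z) -> commsum (x - z).
Proof. by move=> cxy cyz; rewrite -(subrKA y); apply: commsumD. Qed.

Lemma commsum_sub x y : commsum (x - y) -> commsum y -> commsum x.
Proof. by move=> cxy cy; rewrite -(subrK y x); apply: commsumD. Qed.

Lemma commsumC x y : commsum (x * y - y * x).
Proof. by exists [:: (x, y)]; rewrite big_seq1. Qed.

Lemma commsum_sum (I : Type) (r : seq I) (P : pred I) (E : I -> A) :
  (forall i, P i -> commsum (E i)) -> commsum (\sum_(i <- r | P i) E i).
Proof. by move=> cE; elim/big_ind: _ => //; [apply: commsum0 | apply: commsumD]. Qed.

Lemma commsumMn x n : commsum x -> commsum (x *+ n).
Proof.
by move=> cx; elim: n => [|n IH]; rewrite ?mulrS; [apply: commsum0 | apply: commsumD].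
Qed.

Lemma commsumZ c x : (forall y, c * y = y * c) -> commsum x -> commsum (c * x).
Proof.
move=> cC [s ->]; exists [seq (c * u.1, u.2) | u <- s].
rewrite big_map mulr_sumr; apply: eq_bigr => u _ /=.
by rewrite mulrBr !mulrA -(cC u.2).
Qed.

End Commutators.

Lemma commsum_coef (A : nzRingType) (g : {poly A}) i : commsum g -> commsum g`_i.
Proof.
move=> [s ->]; rewrite coef_sum; apply: commsum_sum => -[u v] _ /=.
rewrite coefB coefM coefMr -sumrB; apply: commsum_sum => j _.
exact: commsumC.
Qed.

(* The derivative of (x + y X)^p is congruent to p (x + y X)^(p-1) y = 0 modulo
   commutators, and its coefficients are i s_i, where s_i is the coefficient of
   X^i in (x + y X)^p; hence s_i is a sum of commutators for 0 < i < p. *)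
Lemma commsum_pow_nz (A : nzRingType) (p : nat) (x y : A) :
  prime p -> p%:R = 0 :> A -> commsum ((x + y) ^+ p - x ^+ p - y ^+ p).
Proof.
move=> p_pr pA; pose g : {poly A} := x%:P + y%:P * 'X.
have g0 n : (g ^+ n)`_0 = x ^+ n.
  elim: n => [|n IH]; first by rewrite !expr0 coef1.
  by rewrite !exprS coef0M IH coefD coefC coefMX /= addr0.
have szg n : (size (g ^+ n)%R <= n.+1)%N /\ (g ^+ n)`_n = y ^+ n.
  elim: n => [|n [IHs IHc]]; first by rewrite !expr0 size_poly1 coef1.
  have gE : g ^+ n.+1 = x%:P * g ^+ n + y%:P * g ^+ n * 'X.
    by rewrite exprS mulrDl -!mulrA commr_polyX.
  split; last first.
    rewrite gE coefD coefCM coefMX /= coefCM IHc exprS.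
    by rewrite nth_default ?mulr0 ?add0r.
  apply/leq_sizeP => j lnj; rewrite gE coefD coefCM coefMX coefCM.
  case: j lnj => // j lnj /=; rewrite !nth_default ?mulr0 ?addr0 //.
    exact: leq_trans IHs _.
  by apply: leq_trans IHs _; apply: ltnW.
have gsum n : (x + y) ^+ n = \sum_(i < n.+1) (g ^+ n)`_i.
  have hE : (x + y) ^+ n = (g ^+ n).[1].
    rewrite horner_exp_comm; last by rewrite /comm_poly mul1r mulr1.
    by rewrite hornerD hornerC hornerMX hornerC mulr1.
  rewrite hE (horner_coef_wide _ (szg n).1).
  by apply: eq_bigr => i _; rewrite expr1n mulr1.
have dg n : commsum ((g ^+ n)^`() - g ^+ n.-1 * g^`() *+ n).
  have -> : (g ^+ n)^`() = \sum_(k < n) g ^+ k * g^`() * g ^+ (n.-1 - k).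
    elim: n => [|n IH]; first by rewrite expr0 derivC big_ord0.
    rewrite exprSr derivM IH big_ord_recr /= subnn mulr1 mulr_suml; congr (_ + _).
    apply: eq_bigr => k _; rewrite -!mulrA -exprSr; congr (_ * (_ * g ^+ _)).
    by case: n k {IH} => [[]//|n] k /=; rewrite subSn // -ltnS.
  rewrite -[X in _ *+ X]card_ord -sumr_const -sumrB.
  apply: commsum_sum => k _; rewrite -{2}(subnK (_ : k <= n.-1)%N); last first.
    by case: n k => [[]//|n] k; rewrite -ltnS.
  rewrite exprD -[X in _ - X]mulrA; exact: commsumC.
have pM (z : A) : z *+ p = 0 by rewrite -mulr_natr pA mulr0.
have si i : (0 < i < p)%N -> commsum (g ^+ p)`_i.
  case: i => // i /andP[_ ip].
  have : commsum ((g ^+ p)`_i.+1 *+ i.+1).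
    have := commsum_coef i (dg p); rewrite coefB coefMn pM subr0.
    by rewrite coef_deriv.
  have cop : coprime i.+1 p.
    by rewrite coprime_sym prime_coprime // gtnNdvd.
  move=> /(@commsumMn _ _ (egcdn i.+1 p).1); rewrite -mulrnA.
  case: egcdnP => //= u v uv _; rewrite mulnC uv (eqP cop) mulrnDr.
  by rewrite mulnC mulrnA pM mul0rn add0r.
have [p' Dp] : exists p', p = p'.+1 by exists p.-1; rewrite prednK ?prime_gt0.
rewrite gsum big_ord_recr /= (szg p).2 Dp big_ord_recl /= -Dp g0.
rewrite [x ^+ p + _]addrC [_ + x ^+ p + _]addrAC !addrK.
apply: commsum_sum => i _; apply: si.
by rewrite Dp /bump /= add1n ltnS ltn_ord.
Qed.

Lemma commsum_pow (A : pzRingType) (p : nat) (x y : A) :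
  prime p -> p%:R = 0 :> A -> commsum ((x + y) ^+ p - x ^+ p - y ^+ p).
Proof.
move=> p_pr pA; have [A0|A1] := eqVneq (1 : A) 0.
  by rewrite -[X in commsum X]mulr1 A0 mulr0; apply: commsum0.
pose A' : nzRingType := HB.pack (GRing.PzRing.sort A) (GRing.PzSemiRing_isNonZero.Build A A1).
exact: (@commsum_pow_nz A' p x y).
Qed.

Section Frobenius.
Variables (A : pzRingType) (p : nat) (p_pr : prime p) (pA : p%:R = 0 :> A).
Implicit Types x y : A.

Lemma commsum_mulpow x y n : commsum ((x * y) ^+ n - (y * x) ^+ n).
Proof.
case: n => [|n]; first by rewrite subrr; apply: commsum0.
have -> : (y * x) ^+ n.+1 = y * (x * y) ^+ n * x.
  elim: n => [|n IH]; first by rewrite !expr0 mulr1.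
  by rewrite exprS IH [in RHS]exprS !mulrA.
rewrite exprS -mulrA; exact: commsumC.
Qed.

Lemma commsum_exp x : commsum x -> commsum (x ^+ p).
Proof.
have c0 : commsum ((0 : A) ^+ p) by rewrite expr0n gtn_eqF ?prime_gt0 //; apply: commsum0.
have expD x' y' : commsum (x' ^+ p) -> commsum (y' ^+ p) -> commsum ((x' + y') ^+ p).
  move=> cx cy; apply: commsum_sub (commsumD cx cy).
  by rewrite opprD addrA; apply: commsum_pow.
move=> [s ->]; elim/big_ind: _ => // -[u v] _ /=.
have := commsum_pow (u * v) (- (v * u)) p_pr pA; rewrite -addrA -opprD.
move/commsum_sub; apply; rewrite -(subrK ((v * u) ^+ p) ((u * v) ^+ p)) -addrA.
apply: commsumD (commsum_mulpow u v p) _.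
(* Additivity applied to vu + (-vu) = 0 gives (-vu)^p = -(vu)^p modulo commutators, uniformly in p
   and so also for p = 2. *)
have := commsum_pow (v * u) (- (v * u)) p_pr pA.
rewrite subrr expr0n gtn_eqF ?prime_gt0 // sub0r -opprD => /commsumN.
by rewrite opprK.
Qed.

Lemma commsum_expB x y : commsum (x - y) -> commsum (x ^+ p - y ^+ p).
Proof.
move=> cxy; have := commsum_pow (x - y) y p_pr pA; rewrite subrK addrAC => c.
exact: commsum_sub c (commsum_exp cxy).
Qed.

Variables (q : nat) (f : nat) (qE : q = (p ^ f)%N).

Lemma commsum_expqB x y : commsum (x - y) -> commsum (x ^+ q - y ^+ q).
Proof.
rewrite qE; elim: f => // k IH cxy.
by rewrite expnSr !exprM; apply/commsum_expB/IH.
Qed.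

Lemma commsum_expqD x y : commsum ((x + y) ^+ q - (x ^+ q + y ^+ q)).
Proof.
rewrite qE; elim: f => [|k IH].
  by rewrite expn0 !expr1 subrr; apply: commsum0.
rewrite expnSr !exprM; apply: commsum_trans (commsum_expB IH) _.
by rewrite opprD addrA; apply: commsum_pow.
Qed.

End Frobenius.

(** Finiteness is passed around as an injection into a finite type, so that quotients and twisted
    rings need no finite structure of their own. *)
Lemma pigeonhole_seq (X : Type) (Y : finType) (h : X -> Y) (u : nat -> X) :
  injective h -> exists i d, u i = u (i + d.+1)%N.
Proof.
move=> h_inj; have /injectivePn[i [j ij uij]] : ~~ injectiveb (fun i : 'I_#|Y|.+1 => h (u i)).
  apply/negP => /injectiveP/leq_card; by rewrite card_ord ltnn.
wlog lij : i j ij uij / (i < j)%N => [W|].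
  have [||eij] := ltngtP i j; [exact: W | by apply: W; rewrite 1?eq_sym |].
  by case/eqP: ij; apply: val_inj.
exists i, (j - i).-1; rewrite prednK ?subn_gt0 // subnKC 1?ltnW //.
exact: h_inj.
Qed.

Section FrobeniusNilpotent.
Variables (A : pzRingType) (p : nat) (p_pr : prime p) (pA : p%:R = 0 :> A).
Variables (q f : nat) (qE : q = (p ^ f)%N) (f_gt0 : (0 < f)%N).
Implicit Types x y : A.

(** This is the subspace T(A) of the overview. *)
Definition frobnil x : Prop := exists n, commsum (x ^+ (q ^ n)).

Let qnE n : (q ^ n = p ^ (f * n))%N. Proof. by rewrite qE expnM. Qed.

Lemma q_gt1 : (1 < q)%N.
Proof. by rewrite qE -(exp1n f) ltn_exp2r ?prime_gt1. Qed.

Lemma commsum_expqnB n x y : commsum (x - y) -> commsum (x ^+ (q ^ n) - y ^+ (q ^ n)).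
Proof. exact: commsum_expqB p_pr pA _ _ (qnE n) x y. Qed.

Lemma commsum_expqn n x : commsum x -> commsum (x ^+ (q ^ n)).
Proof.
move=> cx; have := @commsum_expqnB n x 0; rewrite subr0 expr0n gtn_eqF; last first.
  by rewrite expn_gt0 ltnW ?q_gt1.
by rewrite subr0; apply.
Qed.

Lemma commsum_expqnD n x y :
  commsum ((x + y) ^+ (q ^ n) - (x ^+ (q ^ n) + y ^+ (q ^ n))).
Proof. exact: commsum_expqD p_pr pA _ _ (qnE n) x y. Qed.

Lemma commsum_expqn_sum n (I : Type) (r : seq I) (E : I -> A) :
  commsum ((\sum_(i <- r) E i) ^+ (q ^ n) - \sum_(i <- r) E i ^+ (q ^ n)).
Proof.
elim: r => [|i r IH].
  rewrite !big_nil subr0; exact/commsum_expqn/commsum0.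
rewrite !big_cons; apply: commsum_trans (commsum_expqnD _ _ _) _.
by rewrite opprD addrACA subrr add0r.
Qed.

Lemma frobnil_leq x n : commsum (x ^+ (q ^ n)) ->
  forall m, (n <= m)%N -> commsum (x ^+ (q ^ m)).
Proof.
by move=> cx m /subnKC <-; rewrite expnD exprM; apply: commsum_expqn.
Qed.

Lemma frobnil_commsum x : commsum x -> frobnil x.
Proof. by exists 0; rewrite expn0 expr1. Qed.

Lemma frobnil_nilp x k : x ^+ k = 0 -> frobnil x.
Proof.
move=> xk; exists k; have /subnKC <- : (k <= q ^ k)%N by apply/ltnW/ltn_expl/q_gt1.
by rewrite exprD xk mul0r; apply: commsum0.
Qed.

Lemma frobnil_expqn x n : frobnil (x ^+ (q ^ n)) -> frobnil x.
Proof. by case=> m; rewrite -exprM -expnD; exists (n + m)%N. Qed.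

Lemma frobnilD x y : frobnil x -> frobnil y -> frobnil (x + y).
Proof.
move=> [n cx] [m cy]; exists (n + m)%N.
apply: commsum_sub (commsum_expqnD _ x y) _; apply: commsumD.
  exact: frobnil_leq cx _ (leq_addr _ _).
exact: frobnil_leq cy _ (leq_addl _ _).
Qed.

Lemma frobnilZ c x : (forall y, c * y = y * c) -> frobnil x -> frobnil (c * x).
Proof.
move=> cC [n cx]; exists n; rewrite exprMn_comm //; apply: commsumZ => // y.
exact/commr_sym/commrX/commr_sym/cC.
Qed.

Lemma frobnilN x : frobnil x -> frobnil (- x).
Proof. by rewrite -mulN1r; apply: frobnilZ => y; rewrite mulN1r mulrN1. Qed.

Lemma frobnilB x y : frobnil x -> frobnil y -> frobnil (x - y).
Proof. by move=> Tx Ty; apply/frobnilD/frobnilN. Qed.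

(** Injectivity of the q-power map on A / T(A): expanding the power of (x - y) + y leaves the power
    of x - y modulo commutators. *)
Lemma frobnil_expqnB x n y : commsum (x ^+ (q ^ n) - y ^+ (q ^ n)) -> frobnil (x - y).
Proof.
move=> cxy; apply: (@frobnil_expqn _ n); apply: frobnil_commsum.
have := commsum_expqnD n (x - y) y; rewrite subrK => /(commsumB cxy).
by rewrite opprB addrC addrA subrK addrK.
Qed.

(** The sequence x^(q^n) is eventually periodic, and injectivity modulo T(A) cancels the preperiod.
    All multiples of the period d are offered so that the exponent can later be matched with one
    that suits the group elements. *)
Lemma frobnil_perfect (Y : finType) (h : A -> Y) x : injective h ->
  exists2 d, (0 < d)%N & forall n, frobnil (x - x ^+ (q ^ (d * n))).
Proof.
move=> h_inj.
have [i [d xE]] := pigeonhole_seq (fun n => x ^+ (q ^ n)) h_inj.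
have T1 z : z ^+ (q ^ i) = z ^+ (q ^ (i + d.+1)) -> frobnil (z - z ^+ (q ^ d.+1)).
  move=> zE; apply: (@frobnil_expqnB _ i); rewrite -exprM -expnD addnC -zE subrr.
  exact: commsum0.
exists d.+1 => // n; elim: n => [|n IH].
  rewrite muln0 expn0 expr1 subrr; exact/frobnil_commsum/commsum0.
rewrite mulnS addnC expnD exprM; set z := x ^+ _ in IH *.
rewrite -(subrKA z); apply: frobnilD => //; apply: T1.
by rewrite /z -!exprM ![(q ^ (_ * _) * _)%N]mulnC !exprM xE.
Qed.

End FrobeniusNilpotent.

(** * Traces of finite fields of matrices *)

Lemma linear_mxP (F : fieldType) m n (g : 'rV[F]_m -> 'rV[F]_n) :
  (forall c u v, g (c *: u + v) = c *: g u + g v) -> exists M, forall v, g v = v *m M.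
Proof.
move=> gl; pose gL : {linear 'rV[F]_m -> 'rV[F]_n} :=
  HB.pack g (GRing.isLinear.Build _ _ _ _ g gl).
by exists (lin1_mx gL) => v; rewrite mul_rV_lin1.
Qed.

Section MatrixDomain.
Variables (F : finFieldType) (r : nat) (D : subringClosed 'M[F]_r.+1).

Definition mat_sub : Type := {x : 'M[F]_r.+1 | x \in D}.
HB.instance Definition _ := SubFinite.on mat_sub.
HB.instance Definition _ := [SubChoice_isSubNzRing of mat_sub by <:].
HB.instance Definition _ := FinRing.isNzRing.Build mat_sub.

Hypothesis D_unit : forall x, x \in D -> x != 0 -> x \in unitmx.

Lemma mat_sub_domain : GRing.integral_domain_axiom mat_sub.
Proof.
move=> x y xy0; have [//|xN0 /=] := eqVneq x 0; apply/eqP/val_inj.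
have xU : val x \in unitmx by apply: D_unit (valP x) _.
by rewrite -[val y]mul1mx -(mulVmx xU) -mulmxA -[val x *m _]/(val (x * y)) xy0 mulmx0.
Qed.

(** Commutativity comes from Wedderburn's little theorem, through [FinDomainFieldType]. *)
Lemma matrix_domain_field : exists (E : finFieldType) (mx : {rmorphism E -> 'M[F]_r.+1}),
  injective mx /\ forall d, d \in D <-> exists x, mx x = d.
Proof.
pose E := FinDomainFieldType mat_sub_domain.
pose mx : E -> 'M[F]_r.+1 := fun x => val (x : mat_sub).
have mxB : zmod_morphism mx by [].
have mxM : monoid_morphism mx by [].
pose mxR : {rmorphism E -> 'M[F]_r.+1} := HB.pack mx
  (GRing.isZmodMorphism.Build E 'M[F]_r.+1 mx mxB)
  (GRing.isMonoidMorphism.Build E 'M[F]_r.+1 mx mxM).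
exists E, mxR; split=> [|d]; first exact: val_inj.
by split=> [dD|[x <-]]; [exists (Sub d dD : mat_sub) | apply: valP].
Qed.

End MatrixDomain.

Section MatrixField.
Variables (F E : finFieldType) (r : nat) (mx : {rmorphism E -> 'M[F]_r.+1}).
Hypothesis mx_inj : injective mx.
Hypothesis mx_scalar : forall c : F, exists x, mx x = c%:M.
Variable u : 'rV[F]_r.+1.
Hypothesis u_gen : forall v, exists x, u *m mx x = v.

Let q := #|F|.
Let vec (x : E) := u *m mx x.

Let u_neq0 : u != 0.
Proof.
apply/eqP => u0; have [d] := u_gen (delta_mx 0 0).
move/matrixP/(_ 0 0); rewrite u0 mul0mx !mxE !eqxx /= => /esym/eqP.
by rewrite oner_eq0.
Qed.

Let vec_eq0 x : vec x = 0 -> x = 0.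
Proof.
move=> ux0; apply: contraTeq u_neq0 => xN0; rewrite negbK.
by rewrite -[u]mulmx1 -[1%:M](rmorph1 mx) -(divff xN0) rmorphM mulmxA -/(vec x) ux0 mul0mx.
Qed.

Let vec_inj : injective vec.
Proof.
by move=> x y xy; apply/subr0_eq/vec_eq0; rewrite /vec rmorphB mulmxBr -/(vec x) xy subrr.
Qed.

Let vec_surj v : exists x, vec x = v. Proof. exact: u_gen. Qed.

(** The row space is a one-dimensional E-space with generator u, so [vec] is a bijection and E has
    degree r + 1 over F. *)
Let cardE : #|E| = (q ^ r.+1)%N.
Proof.
have [g vK gK] : bijective vec.
  apply: inj_card_bij vec_inj _; have [h hK] := choice vec_surj.
  exact/(@leq_card _ _ h)/(can_inj hK).
by rewrite (bij_eq_card (Bijective vK gK)) card_mx mul1n.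
Qed.

Let q_gt1 : (1 < q)%N. Proof. exact: finNzRing_gt1. Qed.

Let card_field_pow : exists p f : nat, [/\ prime p, p \in [pchar E] & q = (p ^ f)%N].
Proof.
have [p p_pr pF] := finPcharP F; exists p, (logn p q); split=> //.
  rewrite inE p_pr; apply/eqP/mx_inj.
  rewrite rmorph_nat rmorph0 -(raddfMn (@scalar_mx F r.+1)).
  by rewrite (pcharf0 pF) raddf0.
exact: card_pprimeChar pF.
Qed.

Let expqD n (x y : E) : (x + y) ^+ (q ^ n) = x ^+ (q ^ n) + y ^+ (q ^ n).
Proof.
have [p [f [p_pr pE ->]]] := card_field_pow.
by apply: exprDn_pchar; rewrite (eq_pnat _ (pcharf_eq pE)) -expnM pnatX pnat_id.
Qed.

Let q_gt0 : (0 < q)%N. Proof. exact: ltnW q_gt1. Qed.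

Let expq0 n : (0 : E) ^+ (q ^ n) = 0.
Proof. by rewrite expr0n expn_eq0 gtn_eqF. Qed.

Let vecD x y : vec (x + y) = vec x + vec y.
Proof. by rewrite /vec rmorphD mulmxDr. Qed.

Let vecB x y : vec (x - y) = vec x - vec y.
Proof. by rewrite /vec rmorphB mulmxBr. Qed.

Let vecM x y : vec (x * y) = vec x *m mx y.
Proof. by rewrite /vec rmorphM mulmxA. Qed.

Let vecZ c y x : mx y = c%:M -> vec (y * x) = c *: vec x.
Proof. by move=> yc; rewrite /vec rmorphM yc -[_ * _]/(_ *m _) mul_scalar_mx scalemxAr. Qed.

(** The q-power map of E is F-linear because it fixes the scalar matrices; [vec] transports it to
    row vectors. *)
Let frob_mx : exists M, forall x, vec x *m M = vec (x ^+ q).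
Proof.
have [h hK] := choice vec_surj.
have [c v w|M ME] := @linear_mxP F _ _ (fun v => vec (h v ^+ q)); last first.
  by exists M => x; rewrite -ME; congr (vec (_ ^+ q)); apply: vec_inj.
have [y yc] := mx_scalar c.
have -> : h (c *: v + w) = y * h v + h w.
  by apply: vec_inj; rewrite hK vecD (vecZ _ yc) !hK.
have yq : y ^+ q = y.
  by apply: mx_inj; rewrite rmorphXn /= yc -(rmorphXn (@scalar_mx F r.+1)) expf_card.
by rewrite -[q]expn1 expqD exprMn expn1 yq vecD (vecZ _ yc).
Qed.

(** The sum is the value at x of a polynomial of degree at most q^r, which is less than the number
    q^(r+1) of its roots. *)
Let additive_eq0 (d : 'I_r.+1 -> E) :
  (forall x : E, \sum_(i < r.+1) x ^+ (q ^ i) * d i = 0) -> forall i, d i = 0.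
Proof.
move=> d0 i; pose P := \sum_(i < r.+1) d i *: 'X^(q ^ i).
have q_inj : injective (fun i : 'I_r.+1 => (q ^ i)%N).
  by move=> j k /eqP; rewrite eqn_exp2l // => /eqP/ord_inj.
have P0 : P = 0.
  apply: contraTeq isT => PN0.
  have := @max_poly_roots _ P (enum E) PN0; rewrite enum_uniq => /(_ _ isT).
  move=> H.
  have : (size P <= q ^ r.+1)%N.
    apply: leq_trans (size_sum _ _ _) _; apply/bigmax_leqP => j _.
    apply: leq_trans (size_scale_leq _ _) _; rewrite size_polyXn ltn_exp2l //.
  rewrite leqNgt -cardE cardT H //.
  apply/allP => x _; rewrite rootE horner_sum -[X in _ == X](d0 x).
  by apply/eqP/eq_bigr => j _; rewrite hornerZ hornerXn mulrC.
have : P`_(q ^ i) = 0 by rewrite P0 coef0.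
rewrite coef_sum (bigD1 i) //= coefZ coefXn eqxx mulr1 big1 ?addr0 // => j ji.
by rewrite coefZ coefXn (inj_eq q_inj) eq_sym (negPf ji) mulr0.
Qed.

(* With M the matrix of the q-Frobenius map of the field E = D, all matrices are of
   the form sum_i M^i d_i (count them), and tr(M^i d) = 0 for 0 < i < dim E because
   tr(M^i d) = tr(c M^i d c^-1) = tr(M^i c^(q^i) d c^-1). *)
Lemma matrix_field_trace : exists x, \tr (mx x) != 0.
Proof.
have [M vecF] := frob_mx.
have vecMn n x : vec x *m M ^+ n = vec (x ^+ (q ^ n)).
  elim: n x => [|n IH] x; first by rewrite expr0 mulmx1 expr1.
  by rewrite exprS mulmxA vecF IH -exprM expnS.
have mx_ext (X Y : 'M[F]_r.+1) : (forall x, vec x *m X = vec x *m Y) -> X = Y.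
  move=> XY; apply/row_matrixP => i; rewrite !rowE.
  by have [x <-] := vec_surj (delta_mx 0 i).
pose Psi (d : {ffun 'I_r.+1 -> E}) := \sum_(i < r.+1) M ^+ i *m mx (d i).
have vecPsi x d : vec x *m Psi d = vec (\sum_(i < r.+1) x ^+ (q ^ i) * d i).
  rewrite mulmx_sumr /vec raddf_sum mulmx_sumr; apply: eq_bigr => i _.
  by rewrite mulmxA vecMn -vecM.
have Psi_inj : injective Psi.
  move=> d1 d2 e12; apply/ffunP => i; apply/subr0_eq.
  apply: (@additive_eq0 (fun i => d1 i - d2 i)) => x; apply: vec_eq0.
  under eq_bigr do rewrite mulrBr.
  by rewrite sumrB vecB -!vecPsi e12 subrr.
have Psi_onto X : exists d, Psi d = X.
  have : X \in codom Psi.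
    apply: inj_card_onto => //.
    by rewrite card_mx card_ffun card_ord cardE -expnM.
  by case/codomP => d ->; exists d.
have trPsi (i : 'I_r.+1) d : i != ord0 -> \tr (M ^+ i *m mx d) = 0.
  move=> iN0; have [c cq] : exists c : E, c ^+ (q ^ i) - c != 0.
    apply: contrapT => nc.
    (* If the q^i-power map were the identity on E, these coefficients would form a nontrivial
       relation between the powers of Frobenius. *)
    pose d' (j : 'I_r.+1) : E := if j == i then 1 else if j == ord0 then - 1 else 0.
    have /(_ i) : forall i, d' i = 0.
      apply: additive_eq0 => x; rewrite (bigD1 i) //= (bigD1 ord0) 1?eq_sym //= big1.
        rewrite /d' eqxx mulr1 eq_sym (negPf iN0) mulrN1 addr0 expr1.
        by apply/eqP/negPn/negP => xN; apply: nc; exists x.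
      by move=> j /andP[/negPf ji /negPf j0]; rewrite /d' ji j0 mulr0.
    by rewrite /d' eqxx => /eqP; rewrite oner_eq0.
  have cN0 : c != 0.
    by apply: contraNneq cq => ->; rewrite expq0 subrr.
  have cM : mx c *m M ^+ i = M ^+ i *m mx (c ^+ (q ^ i)).
    by apply: mx_ext => x; rewrite !mulmxA vecMn -!vecM vecMn exprMn.
  have tr_eq e : \tr (M ^+ i *m mx (c ^+ (q ^ i) * e)) = \tr (M ^+ i *m mx (e * c)).
    have mxM a b : mx (a * b) = mx a *m mx b by rewrite rmorphM.
    by rewrite !mxM mulmxA -cM -mulmxA mxtrace_mulC mulmxA.
  have := tr_eq (d / (c ^+ (q ^ i) - c)); move/eqP; rewrite -subr_eq0.
  rewrite -raddfB -mulmxBr -rmorphB [_ * c]mulrC -mulrBl mulrCA divff // mulr1.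
  by move/eqP.
apply: contrapT => trD.
have [d dE] := Psi_onto (delta_mx 0 0).
have /eqP : \tr (delta_mx 0 0 : 'M[F]_r.+1) = 0.
  rewrite -dE raddf_sum big1 // => i _.
  have [->|iN0] := eqVneq i ord0; last exact: trPsi.
  rewrite mul1mx; apply/eqP/negPn/negP => trN; apply: trD.
  by exists (d ord0).
rewrite /mxtrace (bigD1 0) //= big1 ?addr0; first by rewrite mxE !eqxx oner_eq0.
by move=> i iN0; rewrite mxE (negPf iN0).
Qed.

End MatrixField.

(** * Trace forms from irreducible matrix representations *)

Section MatrixRep.
Variables (F : fieldType) (A : pzRingType) (iota : {rmorphism F -> A}).
Variables (N : nat) (vec : A -> 'rV[F]_N) (unvec : 'rV[F]_N -> A).
Hypothesis iotaC : forall c x, iota c * x = x * iota c.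
Hypothesis vec_lin : forall c x y, vec (iota c * x + y) = c *: vec x + vec y.
Hypothesis vecK : cancel vec unvec.
Hypothesis unvecK : cancel unvec vec.

Definition mxrep n (rho : A -> 'M[F]_n) : Prop :=
  [/\ forall c x y, rho (iota c * x + y) = c *: rho x + rho y,
      forall x y, rho (x * y) = rho x *m rho y
    & rho 1 = 1%:M].

(** Irreducibility in the form that every nonzero vector generates the module. It is vacuous for n =
    0, a case excluded wherever some [rho] value is required to be nonzero. *)
Definition mxrep_irr n (rho : A -> 'M[F]_n) : Prop :=
  forall v w : 'rV[F]_n, v != 0 -> exists a, v *m rho a = w.

Lemma unvec_lin c u v : unvec (c *: u + v) = iota c * unvec u + unvec v.
Proof. by apply: (can_inj vecK); rewrite vec_lin !unvecK. Qed.

Lemma vec0 : vec 0 = 0.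
Proof.
have := vec_lin (-1) 0 0; rewrite mulr0 addr0 scaleN1r addrC => /eqP.
by rewrite subrr => /eqP.
Qed.

Lemma vec_eq0 x : vec x = 0 -> x = 0.
Proof. by rewrite -vec0 => /(can_inj vecK). Qed.

Lemma regular_mxrep : exists rho : A -> 'M[F]_N,
  mxrep rho /\ forall x a, vec (x * a) = vec x *m rho a.
Proof.
have lin a : exists M, forall v, vec (unvec v * a) = v *m M.
  apply: linear_mxP => c u v.
  by rewrite unvec_lin mulrDl -mulrA vec_lin.
have [rho rhoE] := choice lin.
have rhoV x a : vec (x * a) = vec x *m rho a by rewrite -rhoE vecK.
have ext (M M' : 'M[F]_N) : (forall x, vec x *m M = vec x *m M') -> M = M'.
  by move=> MM'; apply/row_matrixP => i; rewrite !rowE -[delta_mx _ _]unvecK.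
exists rho; split=> //; split.
- move=> c x y; apply: ext => z; rewrite mulmxDr -scalemxAr -!rhoV -vec_lin.
  by rewrite mulrDr mulrA -iotaC mulrA.
- by move=> x y; apply: ext => z; rewrite mulmxA -!rhoV mulrA.
- by apply: ext => z; rewrite -rhoV mulr1 mulmx1.
Qed.

Section Rep.
Variables (n : nat) (rho : A -> 'M[F]_n) (rep : mxrep rho).

Lemma mxrep0 : rho 0 = 0.
Proof.
have [lin _ _] := rep; have := lin (-1) 0 0.
rewrite mulr0 addr0 scaleN1r addrC => /eqP.
by rewrite subrr => /eqP.
Qed.

Lemma mxrepD x y : rho (x + y) = rho x + rho y.
Proof.
by have [lin _ _] := rep; rewrite -[x in LHS]mul1r -(rmorph1 iota) lin scale1r.
Qed.

Lemma mxrepZ c x : rho (iota c * x) = c *: rho x.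
Proof. by have [lin _ _] := rep; rewrite -[_ * x]addr0 lin mxrep0 addr0. Qed.

Lemma mxrepN x : rho (- x) = - rho x.
Proof. by rewrite -scaleN1r -mxrepZ // rmorphN1 mulN1r. Qed.

Lemma mxrepX x k : rho (x ^+ k) = rho x ^+ k.
Proof.
have [_ mul one] := rep; elim: k => [|k IH]; first by rewrite !expr0.
by rewrite !exprS mul IH.
Qed.

End Rep.

(** A nonzero v that does not generate everything spans a proper submodule U; [rho1] is the action
    on U and [rho2] the action on the quotient by U. Vectors being rows, y acts first in
    [rho (y * x)]: it maps everything into U, and x then kills U. *)
Lemma mxrep_reduce n (rho : A -> 'M[F]_n) : mxrep rho -> ~ mxrep_irr rho ->
  exists m1 m2 (rho1 : A -> 'M[F]_m1) (rho2 : A -> 'M[F]_m2),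
    [/\ (m1 < n)%N, (m2 < n)%N, mxrep rho1, mxrep rho2
      & forall x y, rho1 x = 0 -> rho2 y = 0 -> rho (y * x) = 0].
Proof.
move=> rep /existsNP[v] /existsNP[w] /not_implyP[vN0 /forallNP nw].
have [lin mul one] := rep.
have [c x y|U UE] := @linear_mxP F _ _ (fun z => v *m rho (unvec z)).
  by rewrite unvec_lin lin mulmxDr scalemxAr.
have {}UE a : vec a *m U = v *m rho a by rewrite -UE vecK.
have Urho a : (U *m rho a <= U)%MS.
  apply/row_subP => i; rewrite row_mul rowE -[delta_mx _ _]unvecK UE -mulmxA -mul -UE.
  exact: submxMl.
have wU : ~~ (w <= U)%MS.
  by apply/negP => /submxP[z zE]; apply: (nw (unvec z)); rewrite -UE unvecK.
have UN0 : (0 < \rank U)%N.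
  rewrite lt0n mxrank_eq0; apply: contraNneq vN0 => U0.
  by rewrite -[v]mulmx1 -one -UE U0 mulmx0.
have Un : (\rank U < n)%N.
  rewrite ltn_neqAle rank_leq_col andbT; apply: contraNneq wU => Un.
  by apply: submx_full; rewrite /row_full Un.
have [W [W' [Z [WK Wrho UZ]]]] : exists (W : 'M_(\rank U, n)) W' (Z : 'M_(_, \rank U)),
    [/\ W *m W' = 1%:M, forall a, W *m rho a *m W' *m W = W *m rho a & U = Z *m W].
  exists (row_base U), (pinvmx (row_base U)), (col_base U); split.
  - by rewrite mulmxVp // row_base_free.
  - by move=> a; rewrite mulmxKpV // eq_row_base (eqmxMr _ (eq_row_base U)).
  - by rewrite mulmx_base.
have [C [C' [CK subC]]] : exists (C : 'M_(n, \rank (cokermx U))) C',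
    C' *m C = 1%:M /\ forall m (X : 'M_(m, n)), (X <= U)%MS = (X *m C == 0).
  exists (col_base (cokermx U)), (pinvmx (col_base (cokermx U))); split.
    by apply: mulVpmx; apply: col_base_full.
  move=> m X; rewrite submxE -{1}[cokermx U]mulmx_base mulmxA.
  apply/eqP/eqP => [|->]; last exact: mul0mx.
  move=> /(congr1 (mulmx^~ (pinvmx (row_base (cokermx U))))).
  by rewrite mul0mx -mulmxA mulmxVp ?mulmx1 // row_base_free.
have Crho a : C *m C' *m rho a *m C = rho a *m C.
  have : ((C *m C' - 1%:M) *m rho a <= U)%MS.
    have /submxP[Y ->] : (C *m C' - 1%:M <= U)%MS.
      by rewrite subC mulmxBl -mulmxA CK mulmx1 mul1mx subrr.
    by rewrite -mulmxA; apply: submx_trans (Urho a); apply: submxMl.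
  by rewrite subC !mulmxBl mul1mx subr_eq0 => /eqP.
exists (\rank U), (\rank (cokermx U)).
exists (fun a => W *m rho a *m W'), (fun a => C' *m rho a *m C).
split=> //.
- by rewrite mxrank_coker ltn_subrL UN0 (leq_ltn_trans _ Un).
- split.
  + by move=> c x y; rewrite lin mulmxDr mulmxDl -scalemxAr -scalemxAl.
  + by move=> x y; rewrite mul !mulmxA Wrho.
  + by rewrite one mulmx1 WK.
- split.
  + by move=> c x y; rewrite lin mulmxDr mulmxDl -scalemxAr -scalemxAl.
  + by move=> x y; rewrite mul -!mulmxA -[in LHS]Crho !mulmxA.
  + by rewrite one mulmx1 CK.
move=> x y Wx Cy; have Ux : U *m rho x = 0 by rewrite UZ -mulmxA -Wrho Wx mul0mx mulmx0.
have /submxP[Y yE] : (rho y <= U)%MS.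
  by rewrite subC -Crho -!mulmxA [C' *m _]mulmxA Cy mulmx0.
by rewrite mul yE -mulmxA Ux mulmx0.
Qed.

(** Descent from the regular representation: if e were nilpotent both on a submodule and on its
    quotient, the sum of the two exponents would make it nilpotent on the whole module. *)
Lemma mxrep_irr_exists e : (forall k, e ^+ k <> 0) ->
  exists n (rho : A -> 'M[F]_n),
    [/\ mxrep rho, mxrep_irr rho & forall k, rho (e ^+ k) <> 0].
Proof.
move=> eN; suff red n (rho : A -> 'M[F]_n) : mxrep rho -> (forall k, rho (e ^+ k) <> 0) ->
    exists n (rho : A -> 'M[F]_n), [/\ mxrep rho, mxrep_irr rho & forall k, rho (e ^+ k) <> 0].
  have [rho [rep rhoE]] := regular_mxrep; apply: (red N rho) => // k rk.
  by apply: (eN k); apply: vec_eq0; rewrite -[e ^+ k]mul1r rhoE rk mulmx0.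
have [k le_nk] := ubnP n; elim: k n le_nk rho => // k IH n le_nk rho rep nn.
have [irr|/(mxrep_reduce rep)] := pselect (mxrep_irr rho); first by exists n, rho.
case=> m1 [m2 [rho1 [rho2 [lt1 lt2 rep1 rep2 nil]]]].
have [n1|/existsNP[k1 /contrapT z1]] := pselect (forall k, rho1 (e ^+ k) <> 0).
  exact: IH (leq_trans lt1 _) _ rep1 n1.
have [n2|/existsNP[k2 /contrapT z2]] := pselect (forall k, rho2 (e ^+ k) <> 0).
  exact: IH (leq_trans lt2 _) _ rep2 n2.
by case: (nn (k2 + k1)%N); rewrite exprD nil.
Qed.

End MatrixRep.

Lemma rank_factorization (F : fieldType) m n r (M : 'M[F]_(m, n)) : \rank M = r ->
  exists (C : 'M_(m, r)) (R : 'M_(r, n)) C' R',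
    [/\ M = C *m R, C' *m C = 1%:M & R *m R' = 1%:M].
Proof.
move=> <-; exists (col_base M), (row_base M), (pinvmx (col_base M)), (pinvmx (row_base M)).
split; first by rewrite mulmx_base.
  by apply: mulVpmx; apply: col_base_full.
by rewrite mulmxVp // row_base_free.
Qed.

Lemma finField_card_pchar (F : finFieldType) (p : nat) : prime p -> p%:R = 0 :> F ->
  exists2 f, (0 < f)%N & #|F| = (p ^ f)%N.
Proof.
move=> p_pr pF; have pcharFp : p \in [pchar F] by rewrite inE p_pr pF eqxx.
exists (logn p #|F|); last exact: card_pprimeChar pcharFp.
rewrite lt0n; apply/eqP => l0; have := card_pprimeChar pcharFp.
by rewrite l0 expn0 => F1; have := finNzRing_gt1 F; rewrite F1.
Qed.

Lemma mxtrace_commsum (F : fieldType) n (M : 'M[F]_n) : commsum M -> \tr M = 0.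
Proof.
move=> [s ->]; rewrite raddf_sum big1 // => -[X Y] _ /=.
by rewrite raddfB /= [\tr (Y * X)]mxtrace_mulC subrr.
Qed.

(* Modulo commutators, M^q is the sum of the q-th powers of the one-entry
   matrices M_ij E_ij. *)
Lemma mxtrace_expq (F : finFieldType) n (M : 'M[F]_n) : \tr (M ^+ #|F|) = \tr M.
Proof.
have [p p_pr /andP[_ /eqP pF]] := finPcharP F.
have [f f_gt0 qE] := finField_card_pchar p_pr pF.
have pM : p%:R = 0 :> 'M[F]_n.
  by rewrite -(raddfMn (@scalar_mx F n)) pF raddf0.
have := @commsum_expqn_sum _ _ p_pr pM _ _ qE f_gt0 1 _ (index_enum _)
  (fun ij : 'I_n * 'I_n => M ij.1 ij.2 *: delta_mx ij.1 ij.2).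
rewrite expn1 -(pair_bigA _ (fun i j => M i j *: delta_mx i j)) /= -matrix_sum_delta.
move/mxtrace_commsum; rewrite raddfB /= => /subr0_eq ->.
rewrite [in RHS](matrix_sum_delta M) (pair_bigA _ (fun i j => M i j *: delta_mx i j)) /=.
rewrite !raddf_sum; apply: eq_bigr => -[i j] _ /=.
set X := _ *: _; pose b := M i j *+ (i == j).
have trX : \tr X = b.
  rewrite /X mxtraceZ /mxtrace (bigD1 i) //= big1 ?addr0.
    by rewrite mxE eqxx /= eq_sym mulr_natr eq_sym.
  by move=> k /negPf ki; rewrite mxE ki.
have XX : X *m X = b *: X.
  rewrite -scalemxAl -scalemxAr mul_delta_mx_cond eq_sym /X /b.
  by case: (i == j); rewrite ?mulr0n ?scaler0 ?scale0r.
have XS k : X ^+ k.+1 = b ^+ k *: X.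
  elim: k => [|k IH]; first by rewrite expr1 scale1r.
  by rewrite exprS IH -[_ * _]/(_ *m _) -scalemxAr XX scalerA exprSr.
have -> : #|F| = #|F|.-1.+1 by rewrite prednK // ltnW ?finNzRing_gt1.
by rewrite XS mxtraceZ trX -exprSr prednK ?expf_card // ltnW ?finNzRing_gt1.
Qed.

Section TraceForm.
Variables (F : finFieldType) (A : pzRingType) (iota : {rmorphism F -> A}).
Variables (N : nat) (vec : A -> 'rV[F]_N) (unvec : 'rV[F]_N -> A).
Hypothesis iotaC : forall c x, iota c * x = x * iota c.
Hypothesis vec_lin : forall c x y, vec (iota c * x + y) = c *: vec x + vec y.
Hypothesis vecK : cancel vec unvec.
Hypothesis unvecK : cancel unvec vec.

(* If y has minimal nonzero rank r in the ideal P and rho y = C R is a full rank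
   factorization, then R rho(A) C is a division ring of r x r matrices which
   acts simply transitively on the nonzero row vectors; it contains 1, so that
   y is equal to y a y for some a. *)
Lemma mxrep_irr_trace n (rho : A -> 'M[F]_n) (P : A -> Prop) z :
    mxrep iota rho -> mxrep_irr rho ->
    (forall a x, P x -> P (a * x)) -> (forall a x, P x -> P (x * a)) ->
    P z -> rho z <> 0 ->
  exists b1 b2, [/\ P b1, P b2 & \tr (rho (b1 * b2)) <> 0].
Proof.
move=> rep irr PL PR Pz rz; have [_ mul one] := rep.
pose Q r := `[< exists y, [/\ P y, rho y <> 0 & \rank (rho y) = r] >].
have exQ : exists r, Q r by exists (\rank (rho z)); apply/asboolP; exists z.
case: (ex_minnP exQ) => r0 /asboolP[y [Py ry rk_y]] minQ.
have [r Dr] : exists r, r0 = r.+1.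
  exists r0.-1; rewrite prednK // lt0n -rk_y mxrank_eq0; exact/eqP.
have {minQ} rk_min x : P x -> rho x <> 0 -> (r < \rank (rho x))%N.
  by move=> Px rx; rewrite -Dr minQ //; apply/asboolP; exists x.
have [C [R [C' [R' [yE CK RK]]]]] := rank_factorization (etrans rk_y Dr).
(* Since C R = rho y, the product of the matrices of a and b is the matrix of a y b; minimality of
   the rank of y makes every nonzero member invertible. *)
pose D : {pred 'M[F]_r.+1} := fun X => `[< exists a, X = R *m rho a *m C >].
have DP a : R *m rho a *m C \in D by apply/asboolP; exists a.
have D_unit X : X \in D -> X != 0 -> X \in unitmx.
  move=> /asboolP[a XE] XN0; rewrite -row_free_unit -row_leq_rank.
  have yay : rho (y * a * y) = C *m X *m R by rewrite !mul yE XE !mulmxA.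
  apply: leq_trans (rk_min (y * a * y) _ _) _; first exact: PL.
    rewrite yay => /(congr1 (fun M => C' *m M *m R')).
    rewrite !mulmxA CK mul1mx -mulmxA RK mulmx1 mulmx0 mul0mx; exact/eqP.
  by rewrite yay (leq_trans (mxrankM_maxl _ _)) ?mxrankM_maxr.
have gen (u w : 'rV_r.+1) : u != 0 -> exists a, u *m (R *m rho a *m C) = w.
  move=> uN0; have uR : u *m R != 0.
    apply: contraNneq uN0 => uR0.
    by rewrite -[u]mulmx1 -RK mulmxA uR0 mul0mx.
  have [a aE] := irr (u *m R) (w *m C') uR.
  by exists a; rewrite !mulmxA aE -mulmxA CK mulmx1.
have DM X Y : X \in D -> Y \in D -> X * Y \in D.
  move=> /asboolP[a ->] /asboolP[b ->].
  have -> : R *m rho a *m C * (R *m rho b *m C) = R *m rho (a * y * b) *m C.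
    by rewrite !mul yE -[_ * _]/(_ *m _) !mulmxA.
  exact: DP.
pose u1 : 'rV[F]_r.+1 := delta_mx 0 0.
have u1N0 : u1 != 0.
  by apply/eqP => /matrixP/(_ 0 0)/eqP; rewrite !mxE !eqxx oner_eq0.
(* An invertible member of the finite multiplicative set D has the identity among its positive
   powers. *)
have D1 : 1 \in D.
  have [a aE] := gen _ u1 u1N0; set X := R *m _ *m C in aE.
  have XN0 : X != 0 by apply: contraNneq u1N0 => X0; rewrite -aE X0 mulmx0.
  have XU : X \is a GRing.unit by apply: D_unit => //; apply: DP.
  have [i [d XX]] := @pigeonhole_seq _ _ id (fun k => X ^+ k) (fun _ _ => id).
  have <- : X ^+ d.+1 = 1.
    by apply: (mulrI (unitrX i XU)); rewrite mulr1 -exprD -XX.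
  by elim: d {XX} => [|d IH]; [rewrite expr1; apply: DP | rewrite exprS DM ?DP].
have D_closed : subring_closed D.
  split=> // X Y /asboolP[a ->] /asboolP[b ->].
  have -> : R *m rho a *m C - R *m rho b *m C = R *m rho (a - b) *m C.
    by rewrite (mxrepD rep) (mxrepN rep) mulmxBr mulmxBl.
  exact: DP.
pose Ds : subringClosed 'M[F]_r.+1 := HB.pack D (GRing.isSubringClosed.Build _ D D_closed).
have [E [mx [mx_inj mxP]]] := @matrix_domain_field F r Ds D_unit.
have /asboolP[a1 a1E] := D1.
have [x|w|x tr_x] := @matrix_field_trace F E r mx mx_inj _ u1 _.
- apply/mxP; have -> : x%:M = R *m rho (iota x * a1) *m C; last exact: DP.
  by rewrite (mxrepZ rep) -scalemxAr -scalemxAl -a1E -scalemx1.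
- have [a <-] := gen u1 w u1N0.
  by have [x xE] := (mxP _).1 (DP a); exists x; rewrite xE.
have /asboolP[a xE] := (mxP (mx x)).2 (ex_intro _ x erefl).
(* The matrix of a1 is the identity, so y a1 y acts as y, and the trace of a y a1 y is that of C R
   moved around, namely the nonzero trace of R rho(a) C. *)
exists (a * y), (a1 * y); split; [exact: PL | exact: PL |].
have yay : rho (y * (a1 * y)) = rho y.
  rewrite !mul yE mulmxA -[C *m R *m _]mulmxA -[C *m _ *m _]mulmxA.
  by rewrite [R *m _ *m _]mulmxA -a1E mul1mx.
rewrite -mulrA mul yay yE mulmxA mxtrace_mulC mulmxA -xE; exact/eqP.
Qed.

Let q := #|F|.

Definition trace_form (lam : A -> F) : Prop :=
  [/\ forall c x y, lam (iota c * x + y) = c * lam x + lam y,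
      forall x y, lam (x * y) = lam (y * x)
    & forall x, lam (x ^+ q) = lam x].

Definition nil_left_ideal (x : A) : Prop := forall a, exists k, (a * x) ^+ k = 0.

Lemma mxtrace_form n (rho : A -> 'M[F]_n) : mxrep iota rho ->
  trace_form (fun x => \tr (rho x)).
Proof.
move=> rep; have [lin mul one] := rep; split.
- by move=> c x y; rewrite lin mxtraceD mxtraceZ.
- by move=> x y; rewrite !mul mxtrace_mulC.
- by move=> x; rewrite (mxrepX rep) mxtrace_expq.
Qed.

Lemma trace_formD lam1 lam2 : trace_form lam1 -> trace_form lam2 ->
  trace_form (fun x => lam1 x + lam2 x).
Proof.
move=> [l1 c1 q1] [l2 c2 q2]; split.
- by move=> c x y; rewrite l1 l2 mulrDr addrACA.
- by move=> x y; rewrite c1 c2.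
- by move=> x; rewrite q1 q2.
Qed.

Lemma trace_form_expqn lam x n : trace_form lam -> lam (x ^+ (q ^ n)) = lam x.
Proof.
by move=> [_ _ lq]; elim: n => [|n IH]; rewrite ?expr1 // expnSr exprM lq.
Qed.

Lemma trace_form0 lam : trace_form lam -> lam 0 = 0.
Proof.
move=> [lin _ _]; have := lin (-1) 0 0; rewrite mulr0 addr0 mulN1r addrC => /eqP.
by rewrite subrr => /eqP.
Qed.

Lemma trace_form_nil lam x k : trace_form lam -> x ^+ k = 0 -> lam x = 0.
Proof.
move=> lf xk; rewrite -(trace_form_expqn x k lf).
have /subnKC <- : (k <= q ^ k)%N by apply/ltnW/ltn_expl/finNzRing_gt1.
by rewrite exprD xk mul0r trace_form0.
Qed.

(** If e in the radical of lam is not nilpotent, an irreducible [rho] nonzero on all powers of e is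
    available. The radical of lam + tr rho lies in the kernel of [rho], hence in the radical of lam,
    and it misses e. *)
Lemma trace_form_exists :
  exists2 lam, trace_form lam
    & forall x, (forall y, lam (x * y) = 0) <-> nil_left_ideal x.
Proof.
pose rad lam (x : A) := forall y, lam (x * y) = 0 :> F.
pose Rad lam := [set v : 'rV[F]_N | `[< rad lam (unvec v) >]]%SET.
suff min lam : trace_form lam -> exists2 lam, trace_form lam
    & forall x, rad lam x <-> nil_left_ideal x.
  apply: (min (fun=> 0)); split=> // *; by rewrite mulr0 addr0.
have [m] := ubnP #|Rad lam|; elim: m lam => // m IH lam lam_m lf.
have nil_rad x : nil_left_ideal x -> rad lam x.
  move=> nx y; have [_ lC _] := lf; rewrite lC; have [k] := nx y.
  exact: trace_form_nil.
have [rad_nil|/existsNP[x /not_implyP[rx /existsNP[a nax]]]] :=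
    pselect (forall x, rad lam x -> nil_left_ideal x).
  by exists lam => // x; split; [apply: rad_nil | apply: nil_rad].
have radL b z : rad lam z -> rad lam (b * z).
  by have [_ lC _] := lf; move=> rz y; rewrite -mulrA lC -mulrA.
have radR b z : rad lam z -> rad lam (z * b).
  by move=> rz y; rewrite -mulrA.
pose e := a * x; have re : rad lam e by apply: radL.
have eN k : e ^+ k <> 0 by move/forallNP: nax => /(_ k).
have [n [rho [rep irr rhoN]]] := mxrep_irr_exists iotaC vec_lin vecK unvecK eN.
have [_ mul one] := rep.
have tf := mxtrace_form rep; have [tl tC _] := tf; have [ll lC _] := lf.
apply: (IH _ _ (trace_formD lf tf)).
rewrite -ltnS (leq_trans _ lam_m) // ltnS; apply: proper_card.
have rho_eq0 b : rad (fun x => lam x + \tr (rho x)) b -> rho b = 0.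
  move=> rb; apply: contrapT => rhob.
  (* An ideal on whose products tr rho vanishes. If [rho b] were nonzero, irreducibility would
     provide s with [rho (b * s * e)] nonzero, and b s e lies in this ideal, against
     [mxrep_irr_trace]. *)
  pose P z := rad lam z /\ forall y, rad lam y -> \tr (rho (z * y)) = 0.
  have [v vN0] : exists v : 'rV_n, v *m rho b != 0.
    apply: contrapT => nv; apply: rhob; apply/row_matrixP => i.
    rewrite rowE row0; apply/eqP/negPn/negP => H.
    by apply: nv; exists (delta_mx 0 i).
  have [u uN0] : exists u : 'rV_n, u *m rho e != 0.
    apply: contrapT => nv; apply: (rhoN 1%N); rewrite expr1; apply/row_matrixP => i.
    rewrite rowE row0; apply/eqP/negPn/negP => H.
    by apply: nv; exists (delta_mx 0 i).
  have [s sE] := irr _ u vN0.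
  have [||||b1 [b2 [[_ Pb1] [Pb2 _]]]] := @mxrep_irr_trace n rho P (b * s * e) rep irr.
  - move=> c z [rz Pz]; split=> [|y ry]; first exact: radL.
    by rewrite -mulrA tC -mulrA; apply/Pz/radR.
  - move=> c z [rz Pz]; split=> [|y ry]; first exact: radR.
    by rewrite -mulrA; apply/Pz/radL.
  - split=> [|y ry]; first exact: radL.
    have rsy : rad lam (s * e * y) by apply/radR/radL.
    by have := rb (s * e * y); rewrite lC rsy add0r !mulrA.
  - rewrite mul [rho (b * s)]mul => H; move/eqP: uN0; apply.
    by rewrite -sE -2!mulmxA [rho b *m _]mulmxA H mulmx0.
  by case; apply: Pb1.
apply/properP; split.
  apply/fintype.subsetP => v; rewrite !inE => rv y.
  by have := rv y; rewrite mul rho_eq0 // mul0mx mxtrace0 addr0.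
exists (vec e); rewrite !inE vecK //.
by apply/asboolP => /rho_eq0; apply: (rhoN 1%N).
Qed.

End TraceForm.

(** * Maximal left ideals and dimensions *)

Section LeftIdeals.
Variable R : pzRingType.

Lemma left_idealD (I : set R) x y : left_ideal I -> I x -> I y -> I (x + y).
Proof.
move=> [I0 IB _] Ix Iy; rewrite -[y]opprK; apply: (IB) => //.
by rewrite -sub0r; apply: IB.
Qed.

Lemma maximal_left_ideal_exists (I : set R) : left_ideal I -> ~ I 1 ->
  exists2 M, maximal_left_ideal M & (I `<=` M)%classic.
Proof.
move=> Il I1.
pose P : set (set R) :=
  [set N | N = set0 \/ [/\ left_ideal N, (I `<=` N)%classic & ~ N 1]]%classic.
have [F FP Ftot|M [PM Mmax]] := @Zorn_bigcup R P.
  have [[N0 FN0 [x0 N0x0]]|nF] := pselect (exists2 N, F N & N !=set0)%classic; last first.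
    left; apply/seteqP; split=> // x [N FN Nx]; apply: nF.
    by exists N => //; exists x.
  have FI N : F N -> N !=set0%classic ->
      [/\ left_ideal N, (I `<=` N)%classic & ~ N 1].
    by move=> FN [x Nx]; case: (FP N FN) => // N_0; rewrite N_0 in Nx.
  have [[N00 N0B N0M] IN0 _] := FI _ FN0 (ex_intro _ _ N0x0).
  right; split.
  - split; first by exists N0.
    + move=> x y [X FX Xx] [Y FY Yy].
      have [[_ XB _] _ _] := FI _ FX (ex_intro _ _ Xx).
      have [[_ YB _] _ _] := FI _ FY (ex_intro _ _ Yy).
      have [XY|YX] := Ftot _ _ FX FY.
        by exists Y => //; apply: YB => //; apply: XY.
      by exists X => //; apply: XB => //; apply: YX.
    + move=> a x [X FX Xx]; exists X => //.
      by have [[_ _ XM] _ _] := FI _ FX (ex_intro _ _ Xx); apply: XM.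
  - by move=> x Ix; exists N0 => //; apply: IN0.
  - by move=> [X FX X1]; have [_ _] := FI _ FX (ex_intro _ _ X1).
have IP : P I by right; split.
have [I0 _ _] := Il.
case: PM => [M0|[Ml IM M1]].
  by case: (Mmax I) => //; rewrite M0; split=> [x []//|/(_ 0 I0)].
exists M => //; split=> // N Nl MN N1; apply/seteqP; split=> // x Nx.
apply: contrapT => nMx; apply: (Mmax N).
  by split=> // NM; apply: nMx; apply: NM.
by right; split=> // y Iy; apply/MN/IM.
Qed.

Lemma maximal_left_ideal_span (M : set R) x : maximal_left_ideal M -> ~ M x ->
  exists a, M (1 - a * x).
Proof.
move=> [Ml M1 Mmax] nMx; have [M0 MB MM] := Ml; apply: contrapT => nM.
have NE : (fun y => exists a, M (y - a * x)) = M.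
  apply: Mmax => [|y My|//]; last by exists 0; rewrite mul0r subr0.
  split=> [|y z [a ya] [b zb]|c y [a ya]]; first by exists 0; rewrite mul0r subr0.
    by exists (a - b); rewrite mulrBl opprD addrACA -opprD; apply: MB.
  by exists (c * a); rewrite -mulrA -mulrBr; apply: MM.
by apply: nMx; rewrite -NE; exists 1; rewrite mul1r subrr.
Qed.

Lemma jac_left_inverse (x : R) : Jac R x -> exists b, b * (1 - x) = 1.
Proof.
move=> Jx; apply: contrapT => nb.
pose I : set R := [set y | exists b, y = b * (1 - x)]%classic.
have Il : left_ideal I.
  split=> [|y z [a ->] [b ->]|c y [a ->]]; first by exists 0; rewrite mul0r.
    by exists (a - b); rewrite mulrBl.
  by exists (c * a); rewrite mulrA.
have [|M maxM IM] := maximal_left_ideal_exists Il.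
  by move=> [b b1]; apply: nb; exists b.
have [Ml M1 _] := maxM; apply: M1.
rewrite -(subrK x 1); apply: left_idealD => //; last exact: Jx.
by apply: IM; exists 1; rewrite mul1r.
Qed.

Lemma nil_left_ideal_jac (x : R) : nil_left_ideal x -> Jac R x.
Proof.
move=> nx M maxM; apply: contrapT => nMx; have [Ml M1 _] := maxM.
have [a Ma] := maximal_left_ideal_span maxM nMx.
have [k axk] := nx a; apply: M1; have [_ _ MM] := Ml.
have -> : 1 = (\sum_(i < k) (a * x) ^+ i) * (1 - a * x); last exact: MM.
have := subrX1 (a * x) k; rewrite axk sub0r => /(congr1 -%R).
rewrite opprK -mulNr opprB => {1}->.
elim: k {axk} => [|k IH]; first by rewrite big_ord0 mulr0 mul0r.
rewrite big_ord_recr /= [LHS]mulrDr [RHS]mulrDl IH; congr (_ + _).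
by rewrite mulrBl mulrBr mul1r mulr1 -exprS -exprSr.
Qed.

(** Some power e of a x is idempotent. As e lies in the radical, 1 - e has a left inverse, and (1 -
    e) e = 0 forces e = 0. *)
Lemma finite_jacP (Y : finType) (h : R -> Y) (x : R) : injective h ->
  Jac R x <-> nil_left_ideal x.
Proof.
move=> h_inj; split; last exact: nil_left_ideal_jac.
move=> Jx a; set y := a * x.
have Jy : Jac R y by have [_ _ JM] := ideal_left (Jac R); apply: JM.
have [i [d yi]] := pigeonhole_seq (fun n => y ^+ n) h_inj.
(* The exponent is a multiple of the period beyond the preperiod, which makes e idempotent; [i.+1]
   keeps it positive, so that e stays in the radical. *)
pose e := y ^+ (i.+1 * d.+1).
have y1 k : (i <= k)%N -> y ^+ (k + d.+1) = y ^+ k.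
  by move=> /subnKC <-; rewrite addnAC exprD -yi -exprD.
have yd k j : (i <= k)%N -> y ^+ (k + j * d.+1) = y ^+ k.
  move=> ik; elim: j => [|j IH]; first by rewrite mul0n addn0.
  by rewrite mulSn addnCA addnC y1 // (leq_trans ik) ?leq_addr.
have ee : e * e = e.
  by rewrite /e -exprD yd // mulnS leqW // leq_addr.
have Je : Jac R e by rewrite /e mulSn exprD exprS -mulrA; apply: (ideal_right _ Jy).
have [b be] := jac_left_inverse Je.
exists (i.+1 * d.+1)%N; rewrite -/e -[e]mul1r -be -mulrA mulrBl mul1r ee subrr.
by rewrite mulr0.
Qed.

End LeftIdeals.

Section ResidueDim.

Lemma residue_dim_morph (S : comPzRingType) (A B : pzRingType) (w : S)
    (f : {rmorphism S -> A}) (g : {rmorphism S -> B}) (h : {rmorphism A -> B})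
    (U W : set A) (U' W' : set B) n :
  (forall y, exists x, h x = y) -> (forall s, h (f s) = g s) ->
  (forall x, U x <-> U' (h x)) -> (forall x, W x <-> W' (h x)) ->
  residue_dim f w U W n <-> residue_dim g w U' W' n.
Proof.
move=> h_surj hf hU hW.
have hsum m (a : 'I_m -> S) e : h (\sum_i f (a i) * e i) = \sum_i g (a i) * h (e i).
  by rewrite rmorph_sum; apply: eq_bigr => i _; rewrite rmorphM /= hf.
split=> [[e [eU eS eI]]|[e' [eU eS eI]]].
  exists (h \o e); split=> [i|y Uy|a]; first exact/hU.
    have [x xy] := h_surj y; have [|a ax] := eS x; first by apply/hU; rewrite xy.
    by exists a; move/hW: ax; rewrite rmorphB /= hsum xy.
  by rewrite -eI hW hsum.
have [e eE] := choice (fun i => h_surj (e' i)).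
have hsum' a : h (\sum_i f (a i) * e i) = \sum_i g (a i) * e' i.
  by rewrite hsum; apply: eq_bigr => i _; rewrite eE.
exists e; split=> [i|x Ux|a]; first by apply/hU; rewrite eE.
  have [|a ax] := eS (h x); first exact/hU.
  by exists a; apply/hW; rewrite rmorphB /= hsum'.
by rewrite -eI hW hsum'.
Qed.

Lemma residue_dim_fin (S : comPzRingType) (A : pzRingType) (w : S)
    (f : {rmorphism S -> A}) (U W : set A) (I : finType) (e : I -> A) :
  (forall i, U (e i)) ->
  (forall x, U x -> exists a : I -> S, W (x - \sum_i f (a i) * e i)) ->
  (forall a : I -> S, W (\sum_i f (a i) * e i) <-> forall i, multiples w (a i)) ->
  residue_dim f w U W #|I|.
Proof.
move=> eU eS eI; exists (e \o enum_val); split=> [i|x Ux|a]; first exact: eU.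
  have [a ax] := eS x Ux; exists (a \o enum_val).
  move: ax; rewrite (reindex_onto enum_val enum_rank) => [|i _]; last exact: enum_rankK.
  by under eq_bigl do rewrite enum_valK eqxx.
have -> : \sum_i f (a i) * (e \o enum_val) i = \sum_i f ((a \o enum_rank) i) * e i.
  rewrite [RHS](reindex_onto enum_val enum_rank) => [|i _]; last exact: enum_rankK.
  by apply: eq_big => i; rewrite /= enum_valK ?eqxx.
rewrite eI; split=> aw i; last exact: aw.
by have := aw (enum_val i); rewrite /= enum_valK.
Qed.

Lemma multiples0 (S : comPzRingType) (a : S) : multiples 0 a <-> a = 0.
Proof. by split=> [[b ->]|->]; [rewrite mulr0 | exists 0; rewrite mulr0]. Qed.

(** With T the residue field and 0 in the place of w, [residue_dim] becomes ordinary dimension, so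
    the linear algebra can be done over a field. *)
Lemma residue_dim_base (S T : comPzRingType) (A : pzRingType) (w : S)
    (k : {rmorphism S -> T}) (f : {rmorphism S -> A}) (g : {rmorphism T -> A})
    (U W : set A) n :
  (forall t, exists s, k s = t) -> (forall s, k s = 0 <-> multiples w s) ->
  (forall s, g (k s) = f s) ->
  residue_dim g 0 U W n <-> residue_dim f w U W n.
Proof.
move=> k_surj kw gk.
have gsum a (e : 'I_n -> A) : \sum_i g (k (a i)) * e i = \sum_i f (a i) * e i.
  by apply: eq_bigr => i _; rewrite gk.
split=> -[e [eU eS eI]]; exists e; split=> // [x Ux|a].
- have [b bx] := eS x Ux; have [a aE] := choice (fun i => k_surj (b i)).
  by exists a; rewrite -gsum; under eq_bigr do rewrite aE.
- rewrite -gsum (eI (k \o a)); split=> aw i; first by apply/kw/multiples0/aw.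
  exact/multiples0/kw/aw.
- by have [a ax] := eS x Ux; exists (k \o a); rewrite gsum.
have [b bE] := choice (fun i => k_surj (a i)).
have -> : a = k \o b by apply/funext => i; rewrite /= bE.
rewrite gsum eI; split=> aw i; first by apply/multiples0/kw/aw.
exact/kw/multiples0/aw.
Qed.

Variables (F : fieldType) (A : pzRingType) (iota : {rmorphism F -> A}).
Variables (U W : set A).
Hypothesis WZ : forall c x, W x -> W (iota c * x).

Lemma residue_dim_exists (m : nat) :
    (forall n (e : 'I_n -> A), (forall i, U (e i)) ->
      (forall a : 'I_n -> F, W (\sum_i iota (a i) * e i) -> forall i, a i = 0) ->
      (n <= m)%N) ->
    W 0 ->
  exists n, residue_dim iota 0 U W n.
Proof.
move=> bound W0; pose indep n (e : 'I_n -> A) := (forall i, U (e i)) /\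
  forall a : 'I_n -> F, W (\sum_i iota (a i) * e i) -> forall i, a i = 0.
pose P n := `[< exists e : 'I_n -> A, indep n e >].
have exP : exists n, P n.
  by exists 0; apply/asboolP; exists (fun=> 0); split=> [[]|a _ []].
have maxP n : P n -> (n <= m)%N by move=> /asboolP[e [eU eI]]; apply: bound eI.
case: (ex_maxnP exP maxP) => n /asboolP[e [eU eI]] maxn; exists n, e; split=> // [x Ux|a].
  (* By maximality of n, adding x at index 0 creates a relation; its coefficient at 0 is invertible
     because e is independent. *)
  pose e' (i : 'I_n.+1) := oapp e x (unlift ord0 i).
  have [a [aW aN0]] : exists a : 'I_n.+1 -> F,
      W (\sum_i iota (a i) * e' i) /\ ~ forall i, a i = 0.
    apply: contrapT => na; suff : P n.+1 by move/maxn; rewrite ltnn.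
    apply/asboolP; exists e'; split=> [i|a aW]; first by rewrite /e'; case: unlift.
    by apply: contrapT => aN; apply: na; exists a.
  move: aW; rewrite big_ord_recl /e' unlift_none /=.
  under eq_bigr do rewrite liftK /=.
  move=> aW.
  have [a0|a0N] := eqVneq (a ord0) 0.
    case: aN0 => i; rewrite a0 rmorph0 mul0r add0r in aW.
    by case: (unliftP ord0 i) => [j ->|->//]; apply: (eI (fun j => a (lift ord0 j))).
  exists (fun j => - ((a ord0)^-1 * a (lift ord0 j))).
  have := WZ (a ord0)^-1 aW; rewrite mulrDr mulrA -rmorphM mulVf // rmorph1 mul1r.
  congr W; congr (_ + _); rewrite mulr_sumr -sumrN; apply: eq_bigr => j _.
  by rewrite rmorphN mulNr opprK rmorphM mulrA.
split=> [aW i|a0]; first by apply/multiples0/(eI a).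
by rewrite big1 // => i _; have /multiples0 -> := a0 i; rewrite rmorph0 mul0r.
Qed.

Lemma residue_dim_exists_finite (Y : finType) (h : A -> Y) :
  injective h -> W 0 -> exists n, residue_dim iota 0 U W n.
Proof.
move=> h_inj W0; apply: (@residue_dim_exists #|Y|) => // n e eU eI.
rewrite -[n]card_ord; apply: (@leq_card _ _ (h \o e)); apply: inj_comp => // i j eij.
apply/eqP; apply: contrapT => /negP ij.
pose a k : F := (k == i)%:R - (k == j)%:R.
have /(_ i) : forall k, a k = 0.
  apply: eI; rewrite (bigD1 i) //= (bigD1 j) 1?eq_sym //= big1.
    rewrite /a !eqxx [j == i]eq_sym (negPf ij) subr0 sub0r rmorphN rmorph1 eij.
    by rewrite mulN1r mul1r addr0 subrr.
  by move=> k /andP[/negPf ki /negPf kj]; rewrite /a ki kj subrr rmorph0 mul0r.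
by rewrite /a eqxx (negPf ij) subr0 => /eqP; rewrite oner_eq0.
Qed.

End ResidueDim.

(** * Duality between the center and the trace space *)

Lemma residue_dim_coordinates (F : fieldType) (A : pzRingType)
    (iota : {rmorphism F -> A}) N :
  residue_dim iota 0 [set: A]%classic [set 0]%classic N ->
  exists (vec : A -> 'rV[F]_N) (unvec : 'rV[F]_N -> A),
    [/\ forall c x y, vec (iota c * x + y) = c *: vec x + vec y,
        cancel vec unvec & cancel unvec vec].
Proof.
move=> [e [_ eS eI]].
pose unvec (v : 'rV[F]_N) := \sum_i iota (v 0 i) * e i.
have unvec_lin c u v : unvec (c *: u + v) = iota c * unvec u + unvec v.
  rewrite mulr_sumr -big_split; apply: eq_bigr => i _ /=.
  by rewrite !mxE rmorphD rmorphM mulrDl mulrA.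
have [x|vec vecK] := @choice _ _ (fun x v => unvec v = x).
  have [a /= /subr0_eq ax] := eS x I.
  by exists (\row_i a i); rewrite ax; apply: eq_bigr => i _; rewrite mxE.
have unvec_inj : injective unvec.
  move=> u v uv; apply/subr0_eq/rowP => i; rewrite [RHS]mxE.
  have /eI/(_ i)/multiples0 // : [set 0]%classic (unvec (u - v)).
  by rewrite -scaleN1r addrC unvec_lin uv rmorphN1 mulN1r addNr.
exists vec, unvec; split=> [c x y||] //; last by move=> v; apply: unvec_inj; rewrite vecK.
by apply: unvec_inj; rewrite unvec_lin !vecK.
Qed.

Lemma quot_proj_eq0 (R : pzRingType) (I : twosided R) x : quot_proj I x = 0 <-> I x.
Proof. by rewrite -(rmorph0 (quot_proj I)) quot_projP subr0. Qed.

Definition center_mod_jac (A : pzRingType) : set A :=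
  [set a | forall y, Jac A (a * y - y * a)]%classic.

Lemma center_mod_jacP (A : pzRingType) (a : A) :
  center_mod_jac a <-> center (quot_ring (Jac A)) (quot_proj (Jac A) a).
Proof.
split=> [ca|ca y]; last by apply/quot_projP; rewrite !rmorphM ca.
by elim/quot_ind => y; rewrite -!rmorphM; apply/quot_projP.
Qed.

Section Duality.
Variables (F : finFieldType) (A : pzRingType) (iota : {rmorphism F -> A}) (N p : nat).
Hypotheses (p_pr : prime p) (pF : p%:R = 0 :> F).
Hypothesis iotaC : forall c x, iota c * x = x * iota c.
Hypothesis A_dim : residue_dim iota 0 [set: A]%classic [set 0]%classic N.

(* A trace form with radical Jac A makes the elements central modulo Jac A the
   orthogonal complement of the Frobenius-nilpotent elements. *)
Lemma residue_dim_center_mod_jac n :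
  residue_dim iota 0 [set: A]%classic (frobnil #|F|) n ->
  residue_dim iota 0 (@center_mod_jac A) (Jac A) n.
Proof.
have [vec [unvec [vec_lin vecK unvecK]]] := residue_dim_coordinates A_dim.
have [f f_gt0 qE] := finField_card_pchar p_pr pF.
have pA : p%:R = 0 :> A by rewrite -(rmorph_nat iota) pF rmorph0.
have [lam lf lam_nil] := trace_form_exists iotaC vec_lin vecK unvecK.
have lamP x : (forall y, lam (x * y) = 0) <-> Jac A x.
  by rewrite lam_nil; apply: iff_sym; apply: finite_jacP (can_inj vecK).
have [lin lamC lamX] := lf.
have lamD x y : lam (x + y) = lam x + lam y.
  by rewrite -[x in LHS]mul1r -(rmorph1 iota) lin mul1r.
have lamB x y : lam (x - y) = lam x - lam y.
  by apply/eqP; rewrite eq_sym subr_eq -lamD subrK.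
have lamZ c x : lam (iota c * x) = c * lam x.
  by rewrite -[_ * x]addr0 lin (trace_form0 lf) addr0.
have lam_sum (I : Type) (r : seq I) (G : I -> A) :
    lam (\sum_(i <- r) G i) = \sum_(i <- r) lam (G i).
  exact: (big_morph lam lamD (trace_form0 lf)).
have lam_jac x : Jac A x -> lam x = 0 by move/lamP => /(_ 1); rewrite mulr1.
have lam_comm x : commsum x -> lam x = 0.
  move=> [s ->]; rewrite lam_sum big1 // => -[u v] _.
  by rewrite lamB lamC subrr.
have lam_frob x : frobnil #|F| x -> lam x = 0.
  by move=> [k /lam_comm]; rewrite (trace_form_expqn _ _ lf).
have jac_frob x : Jac A x -> frobnil #|F| x.
  move/(finite_jacP x (can_inj vecK)) => /(_ 1)[k]; rewrite mul1r.
  exact: (frobnil_nilp p_pr qE f_gt0).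
(* Modulo the radical a commutes with t, so lam(a t) = lam(a^m t^m) with t^m a sum of commutators,
   and lam(a^m [u, v]) = lam([a^m, u] v) = 0. *)
have center_lam a t : center_mod_jac a -> frobnil #|F| t -> lam (a * t) = 0.
  move=> /center_mod_jacP ca [k ct]; rewrite -(trace_form_expqn _ k lf).
  set m := (_ ^ k)%N in ct *.
  have cam : center_mod_jac (a ^+ m).
    by apply/center_mod_jacP => y; rewrite rmorphXn; apply/commr_sym/commrX/commr_sym/ca.
  have atm : Jac A ((a * t) ^+ m - a ^+ m * t ^+ m).
    apply/quot_projP; rewrite rmorphXn !rmorphM !rmorphXn exprMn_comm //.
  rewrite -(subrK (a ^+ m * t ^+ m) ((a * t) ^+ m)) lamD lam_jac // add0r.
  case: ct => s ->; rewrite mulr_sumr lam_sum big1 // => -[u v] _ /=.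
  rewrite mulrBr lamB !mulrA [lam (_ * u)]lamC mulrA -lamB -mulrBl.
  by rewrite (lamP _).2.
have lam_center a : (forall t, frobnil #|F| t -> lam (a * t) = 0) -> center_mod_jac a.
  move=> la y; apply/lamP => x; rewrite mulrBl lamB -[y * a * x]mulrA [lam (y * _)]lamC.
  rewrite -!mulrA -lamB -mulrBr; apply: la; apply: frobnil_commsum; exact: commsumC.
(* The radical of the Gram matrix G of lam is Jac A; a form vanishing there is in the row space of
   G, as seen by testing against the cokernel of G. *)
have represent (phi : A -> F) : (forall c x y, phi (iota c * x + y) = c * phi x + phi y) ->
    (forall x, Jac A x -> phi x = 0) -> exists a, forall x, phi x = lam (a * x).
  move=> philin phiJ; pose b j := unvec (delta_mx 0 j).
  have vecE x : x = \sum_j iota (vec x 0 j) * b j.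
    rewrite -[LHS]vecK [vec x in LHS]row_sum_delta.
    have u0 : unvec 0 = 0.
      by apply: (can_inj vecK); rewrite unvecK (vec0 vec_lin).
    elim/big_rec2: _ => // j y z _ <-.
    by rewrite (unvec_lin vec_lin vecK unvecK).
  have phi0 : phi 0 = 0.
    have := philin (-1) 0 0; rewrite mulr0 addr0 mulN1r addrC => /eqP.
    by rewrite subrr => /eqP.
  have phiE x : phi x = \sum_j vec x 0 j * phi (b j).
    rewrite [in LHS](vecE x); elim/big_rec2: _ => // j y z _ <-.
    exact: philin.
  pose G := \matrix_(i, j) lam (b i * b j).
  have lamG x y : lam (x * y) = \sum_j (vec x *m G) 0 j * vec y 0 j.
    rewrite [in LHS](vecE y) mulr_sumr lam_sum; apply: eq_bigr => j _.
    rewrite mulrA -iotaC -mulrA lamZ mulrC; congr (_ * _).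
    rewrite [in LHS](vecE x) mulr_suml lam_sum mxE; apply: eq_bigr => i _.
    by rewrite -mulrA lamZ mxE.
  have : (\row_j phi (b j) <= G)%MS.
    rewrite submxE; apply/eqP/matrixP => i k; rewrite mxE [RHS]mxE.
    pose z := unvec (\row_j cokermx G j k).
    transitivity (phi z); last first.
      apply/phiJ/lamP => y; rewrite lamC lamG unvecK.
      have E : (vec y *m G *m cokermx G) 0 k = 0 by rewrite -mulmxA mulmx_coker mulmx0 mxE.
      by rewrite -[RHS]E [RHS]mxE; apply: eq_bigr => j _; rewrite mxE.
    by rewrite phiE unvecK; apply: eq_bigr => j _; rewrite !mxE mulrC.
  move=> /submxP[v vE]; exists (unvec v) => x.
  rewrite phiE lamG unvecK -vE; apply: eq_bigr => j _.
  by rewrite mxE mulrC.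
move=> [e [_ eS eI]].
have T0 : frobnil #|F| (0 : A) by apply/frobnil_commsum/commsum0.
have TB (x y : A) : frobnil #|F| x -> frobnil #|F| y -> frobnil #|F| (x - y).
  exact: (frobnilB p_pr pA qE f_gt0).
have TD (x y : A) : frobnil #|F| x -> frobnil #|F| y -> frobnil #|F| (x + y).
  exact: (frobnilD p_pr pA qE f_gt0).
have TZ c (x : A) : frobnil #|F| x -> frobnil #|F| (iota c * x).
  exact: frobnilZ.
have [co coE] := choice (fun x => eS x I).
have co_uniq x a : frobnil #|F| (x - \sum_i iota (a i) * e i) -> forall i, co x i = a i.
  move=> xa i; apply/subr0_eq.
  have /(_ i)/multiples0 // : forall i, multiples 0 (co x i - a i).
  apply: (eI (fun i => co x i - a i)).1; have := TB _ _ xa (coE x).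
  rewrite opprB addrC addrA subrK -sumrB; congr (frobnil _ _).
  by apply: eq_bigr => j _; rewrite rmorphB mulrBl.
have co_frob x i : frobnil #|F| x -> co x i = 0.
  move=> Tx; apply: (co_uniq x (fun=> 0)); rewrite big1 ?subr0 // => j _.
  by rewrite rmorph0 mul0r.
have co_lin i c x y : co (iota c * x + y) i = c * co x i + co y i.
  apply: (co_uniq _ (fun i => c * co x i + co y i)).
  have := TD _ _ (TZ c _ (coE x)) (coE y); congr (frobnil _ _).
  rewrite mulrBr addrACA -opprD mulr_sumr -big_split; congr (_ - _).
  by apply: eq_bigr => j _ /=; rewrite rmorphD rmorphM mulrDl mulrA.
have co_e i j : co (e j) i = (i == j)%:R.
  apply: (co_uniq _ (fun i => (i == j)%:R)); rewrite (bigD1 j) //= eqxx rmorph1 mul1r.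
  by rewrite big1 ?addr0 ?subrr // => k /negPf kj; rewrite kj rmorph0 mul0r.
(* The coordinates on A / T(A) vanish on Jac A, whose elements are nilpotent; the d i representing
   them form the dual basis. *)
have [i|d dE] := @choice _ _ (fun i d => forall x, co x i = lam (d * x)).
  apply: represent (co_lin i) _ => x Jx.
  exact/co_frob/jac_frob.
have dZ i : center_mod_jac (d i).
  by apply: lam_center => t Tt; rewrite -dE co_frob.
exists d; split=> // [a Za|a].
  exists (fun i => lam (a * e i)); apply/lamP => x.
  have aT : lam (a * x) = \sum_i lam (a * e i) * co x i.
    have := center_lam a _ Za (coE x); rewrite mulrBr lamB => /subr0_eq ->.
    rewrite mulr_sumr lam_sum; apply: eq_bigr => i _.
    by rewrite mulrA -iotaC -mulrA lamZ mulrC.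
  rewrite mulrBl lamB aT mulr_suml lam_sum -sumrB big1 // => i _.
  by rewrite -mulrA lamZ -dE subrr.
split=> [Ja i|a0].
  apply/multiples0; have /lamP/(_ (e i)) := Ja.
  rewrite mulr_suml lam_sum (bigD1 i) //= -mulrA lamZ -dE co_e eqxx mulr1 big1 ?addr0 //.
  by move=> j ji; rewrite -mulrA lamZ -dE co_e (negPf ji) mulr0.
rewrite big1 => [|i _]; first by have [J0 _ _] := ideal_left (Jac A).
by have /multiples0 -> := a0 i; rewrite rmorph0 mul0r.
Qed.

End Duality.

(** * Twisted group rings over a finite ring *)

Section PRegular.
Variables (gT : finGroupType) (p : nat) (p_pr : prime p).
Implicit Types s t g : gT.

Lemma p_regularE s : (s \in p_regular gT p) = ~~ (p %| #[s]%g)%N.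
Proof. by rewrite inE. Qed.

(** Let n be the group order and m its p'-part. The totient factor of l makes the exponent congruent
    to 1 modulo m, and the factor log_p n + 1 makes it divisible by the p-part of n. The free k
    allows combination with other periods. *)
Lemma p_regular_expn q f : q = (p ^ f)%N -> (0 < f)%N ->
  exists2 l, (0 < l)%N & forall k, (0 < k)%N ->
    (forall t, (t ^+ (q ^ (l * k)))%g \in p_regular gT p) /\
    (forall s, s \in p_regular gT p -> (s ^+ (q ^ (l * k)))%g = s).
Proof.
move=> qE f_gt0; set n := #|[set: gT]|; have n_gt0 : (0 < n)%N by apply: cardG_gt0.
pose m := (n`_p^')%N; have m_gt0 : (0 < m)%N by apply: part_gt0.
have pm : ~~ (p %| m)%N by rewrite -p'natE // part_pnat.
have qm : coprime q m by rewrite qE coprimeXl // prime_coprime.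
exists (totient m * (logn p n).+1)%N; first by rewrite muln_gt0 totient_gt0 m_gt0.
move=> k k_gt0; set x := (q ^ _)%N; split=> [t|s].
  rewrite p_regularE; apply: contra pm => /dvdn_trans; apply.
  rewrite order_dvdn -expgM -order_dvdn.
  apply: (@dvdn_trans n); first exact/order_dvdG/finset.in_setT.
  rewrite -(partnC p n_gt0) dvdn_mul // p_part /x qE -expnM dvdn_exp2l //.
  apply: leq_trans (leqnSn _) _; rewrite !mulnA mulnAC.
  by rewrite leq_pmull // !muln_gt0 f_gt0 totient_gt0 m_gt0 k_gt0.
rewrite p_regularE => ps; rewrite -expg_mod_order.
have sm : (#[s]%g %| m)%N.
  have <- : (#[s]%g`_p^')%N = #[s]%g by apply: part_pnat_id; rewrite p'natE // order_gt0.
  exact/partn_dvd/order_dvdG/finset.in_setT.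
have x1 : x = 1 %[mod m].
  rewrite /x -mulnA expnM -modnXm (Euler_exp_totient qm) modnXm.
  by rewrite exp1n.
by rewrite -(modn_dvdm _ sm) x1 modn_dvdm // expg_mod_order expg1.
Qed.

Variables (Cl : {set gT}) (hCl : p_regular_reps p Cl).

Lemma p_regular_reps_sub s : s \in Cl -> s \in p_regular gT p.
Proof. by move: s; apply/fintype.subsetP; apply: transversal_sub hCl. Qed.

Let card_class t : t \in p_regular gT p -> #|Cl :&: (t ^: [set: gT])%g| = 1%N.
Proof.
move=> pt; have /and3P[_ _ /forall_inP H] := hCl.
by apply/eqP/H; apply/imsetP; exists t.
Qed.

Lemma p_regular_reps_ex t : t \in p_regular gT p ->
  exists2 s, s \in Cl & exists g, (t ^ g)%g = s.
Proof.
move=> /card_class/eqP/cards1P[s sE].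
have : s \in Cl :&: (t ^: [set: gT])%g by rewrite sE set11.
by case/setIP=> sCl /imsetP[g _ sg]; exists s => //; exists g.
Qed.

Lemma p_regular_reps_uniq s t g : s \in Cl -> t \in Cl -> (t ^ g)%g = s -> t = s.
Proof.
move=> sCl tCl tg; have /eqP/cards1P[u uE] := card_class (p_regular_reps_sub tCl).
have : s \in Cl :&: (t ^: [set: gT])%g by rewrite inE sCl -tg memJ_class ?finset.in_setT.
have : t \in Cl :&: (t ^: [set: gT])%g by rewrite inE tCl class_refl.
by rewrite uE => /set1P -> /set1P ->.
Qed.

End PRegular.

Lemma sum_tagged (V : nmodType) (I : finType) (T_ : I -> finType) (G : {i : I & T_ i} -> V) :
  \sum_u G u = \sum_i \sum_(j : T_ i) G (Tagged T_ j).
Proof.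
rewrite (sig_big_dep xpredT (fun _ => xpredT) (fun i j => G (Tagged T_ j))) /=.
by apply: eq_bigr => -[].
Qed.

Lemma Jac_quot_reduced (C : comPzRingType) (Y : finType) (h : C -> Y) :
  injective h -> forall (z : quot_ring (Jac C)) k, z ^+ k = 0 -> z = 0.
Proof.
move=> h_inj; elim/quot_ind => z k; rewrite -rmorphXn => /quot_proj_eq0.
move=> /(finite_jacP _ h_inj)/(_ 1)[m]; rewrite mul1r -exprM => zm.
apply/quot_proj_eq0/(finite_jacP _ h_inj) => a; exists (k * m)%N.
by rewrite exprMn zm mulr0.
Qed.

(** Commutators vanish in a commutative ring, so [frobnil] means nilpotent and [frobnil_perfect]
    becomes an equality in the reduced case. *)
Lemma reduced_perfect (C : comPzRingType) (Y : finType) (h : C -> Y) (p q f : nat) :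
  injective h -> prime p -> p%:R = 0 :> C -> q = (p ^ f)%N -> (0 < f)%N ->
  (forall (z : C) k, z ^+ k = 0 -> z = 0) ->
  forall z : C, exists2 d, (0 < d)%N & forall n, z ^+ (q ^ (d * n)) = z.
Proof.
move=> h_inj p_pr pC qE f_gt0 red z.
have [d d_gt0 zd] := frobnil_perfect p_pr pC qE f_gt0 z h_inj.
exists d => // n; apply/esym/subr0_eq; have [k [s E]] := zd n.
apply: (red _ (q ^ k)%N); rewrite E big1 // => u _; by rewrite mulrC subrr.
Qed.

Section TwistedRing.
Variables (gT : finGroupType) (C : comPzRingType) (act : ringAction gT C).
Local Notation A := (twisted act).
Local Notation elt := (tw_elt act).
Implicit Types (s t g : gT) (y z : C).

Lemma tw_eltM s t y z : elt s y * elt t z = elt (s * t)%g (act y t * z).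
Proof. exact: tw_mul_elt. Qed.

Lemma tw_elt_zmod s : zmod_morphism (elt s).
Proof. by move=> y z; apply/ffunP => r; rewrite !ffunE; case: eqP; rewrite ?subrr. Qed.
HB.instance Definition _ s := GRing.isZmodMorphism.Build C A (elt s) (tw_elt_zmod s).

Lemma tw_sumE (x : A) : x = \sum_s elt s (x s).
Proof.
apply/ffunP => r; have val_sum (I : Type) (l : seq I) (G : I -> A) :
    (\sum_(i <- l) G i) r = \sum_(i <- l) G i r.
  by apply: (big_morph (fun u : A => u r)); [move=> u v|]; rewrite ffunE.
rewrite val_sum (bigD1 r) //= big1 ?ffunE ?eqxx ?addr0 // => s sr.
by rewrite ffunE eq_sym (negPf sr).
Qed.

Lemma tw_eltX s y m : elt s y ^+ m = elt (s ^+ m)%g (\prod_(i < m) act y (s ^+ i)%g).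
Proof.
elim: m => [|m IH]; first by rewrite big_ord0.
rewrite exprSr IH tw_eltM expgSr big_ord_recl /= expg0 ract1 mulrC.
have -> : act (\prod_(i < m) act y (s ^+ i)%g) s = \prod_(i < m) act (act y (s ^+ i)%g) s.
  by elim/big_rec2: _ => [|i u v _ <-]; rewrite ?ract1r ?ractMr.
by congr (elt _ (_ * _)); apply: eq_bigr => i _; rewrite -ractM /bump /= add1n expgSr.
Qed.

Lemma tw_coef_central y : fixed_by act y ->
  forall x : A, tw_coef act y * x = x * tw_coef act y.
Proof.
move=> fy x; rewrite [x]tw_sumE mulr_sumr mulr_suml; apply: eq_bigr => s _.
by rewrite /tw_coef !tw_eltM mul1g mulg1 fy ract1 mulrC.
Qed.

Lemma tw_coefM y s z : fixed_by act y -> tw_coef act y * elt s z = elt s (y * z).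
Proof. by move=> fy; rewrite /tw_coef tw_eltM mul1g fy. Qed.

Lemma commsum_conj s g y : commsum (elt s y - elt (s ^ g)%g (act y g)).
Proof.
have -> : elt s y = elt g 1 * (elt g^-1 1 * elt s y).
  by rewrite mulrA tw_eltM mulgV ract1r mulr1 -/(tw_coef act 1) rmorph1 mul1r.
have -> : elt (s ^ g)%g (act y g) = elt g^-1 1 * elt s y * elt g 1.
  by rewrite !tw_eltM ract1r ?mul1r ?mulr1 conjgE mulgA.
exact: commsumC.
Qed.

(** The power with exponent the order of s lies in C and has y itself as a factor. *)
Lemma tw_elt_nil s y k : y ^+ k = 0 -> exists m, elt s y ^+ m = 0.
Proof.
move=> yk; exists (#[s]%g * k)%N; rewrite exprM tw_eltX expg_order.
rewrite -/(tw_coef act _) -rmorphXn /= -(prednK (order_gt0 s)) big_ord_recl /= expg0 ract1.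
by rewrite exprMn yk mul0r rmorph0.
Qed.

End TwistedRing.

(** * Coinvariants and the trace space of a twisted ring *)

Section Coinvariants.
Variables (F : finFieldType) (gT : finGroupType) (C : comPzRingType) (act : ringAction gT C).
Variables (iota : {rmorphism F -> C}) (iota_fixed : forall c, fixed_by act (iota c)).
Variables (p : nat) (p_pr : prime p) (pF : p%:R = 0 :> F).
Variables (Y : finType) (h : C -> Y) (h_inj : injective h).
Variables (S : comPzRingType) (f : {rmorphism S -> C}).
Hypothesis f_iota : forall a, exists c, f a = iota c.
Implicit Types (s t g : gT) (y z : C).

Local Notation A := (twisted act).
Local Notation elt := (tw_elt act).
Local Notation C0 := (quot_ring (Jac C)).
Local Notation pi := (quot_proj (Jac C)).
Local Notation act0 := (Jac_quot_act act).
Local Notation q := #|F|.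

(** The formulas of [V_gens] and [V_space] for an arbitrary C, to which those are convertible for
    [Tbar]. The span is taken through f; [f_iota] turns its scalars into elements of F. *)
Definition coinv_gens s : set C0 :=
  [set v | (exists y z : C0, v = (act0 y s - y) * z) \/
           (exists (r : gT) (y : C0), r \in 'C[s]%g /\ v = act0 y r - y)]%classic.

Definition coinv_space s : set C0 := lin_span (pi \o f) (coinv_gens s).

Local Notation V := coinv_space.

Let act0E y s : act0 (pi y) s = pi (act y s).
Proof. exact: (quot_act_funE (@Jac_stable gT C act)). Qed.

Let piM y z : pi (y * z) = pi y * pi z. Proof. exact: rmorphM. Qed.

Lemma coinv_gen s v : coinv_gens s v -> V s v.
Proof.
move=> gv; exists 1%N, (fun=> 1), (fun=> v); split=> //.
by rewrite big_ord1 rmorph1 mul1r.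
Qed.

Lemma coinv0 s : V s 0.
Proof. by exists 0%N, (fun=> 0), (fun=> 0); split=> [[]|] //; rewrite big_ord0. Qed.

Lemma coinvD s u v : V s u -> V s v -> V s (u + v).
Proof.
move=> [n [a [x [gx ->]]]] [m [b [y [gy ->]]]].
exists (n + m)%N, (fun i => match fintype.split i with inl j => a j | inr j => b j end),
  (fun i => match fintype.split i with inl j => x j | inr j => y j end); split.
  by move=> i; case: fintype.split.
rewrite big_split_ord /=; congr (_ + _); apply: eq_bigr => i _.
  by rewrite (unsplitK (inl i : 'I_n + 'I_m)%type).
by rewrite (unsplitK (inr i : 'I_n + 'I_m)%type).
Qed.

Lemma coinvZ s a v : V s v -> V s (pi (f a) * v).
Proof.
move=> [n [b [x [gx ->]]]]; exists n, (fun i => a * b i), x; split=> //.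
by rewrite mulr_sumr; apply: eq_bigr => i _; rewrite mulrA -!rmorphM.
Qed.

Lemma coinvN s v : V s v -> V s (- v).
Proof. by move=> Vv; rewrite -mulN1r -(rmorph1 (pi \o f)) -rmorphN; apply: coinvZ. Qed.

Lemma coinvB s u v : V s u -> V s v -> V s (u - v).
Proof. by move=> Vu Vv; apply/coinvD/coinvN. Qed.

Lemma coinv_sum s (I : Type) (r : seq I) (P : pred I) (G : I -> C0) :
  (forall i, P i -> V s (G i)) -> V s (\sum_(i <- r | P i) G i).
Proof. by move=> VG; elim/big_ind: _ => //; [apply: coinv0 | apply: coinvD]. Qed.

Lemma coinv_ideal s (y z : C0) : V s ((act0 y s - y) * z).
Proof. by apply: coinv_gen; left; exists y, z. Qed.

Lemma coinv_cent s r (y : C0) : r \in 'C[s]%g -> V s (act0 y r - y).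
Proof. by move=> rs; apply: coinv_gen; right; exists r, y. Qed.

Lemma pchar_quot : p%:R = 0 :> C0.
Proof. by rewrite -(rmorph_nat (pi \o iota)) pF rmorph0. Qed.

Let pC : p%:R = 0 :> C.
Proof. by rewrite -(rmorph_nat iota) pF rmorph0. Qed.

Let quot_inj : injective (h \o @quot_repr C (Jac C)).
Proof. by apply: (inj_comp h_inj); apply: can_inj (@quot_reprK _ _). Qed.

Let expqD (u v : C0) : (u + v) ^+ q = u ^+ q + v ^+ q.
Proof.
have [k k_gt0 qE] := finField_card_pchar p_pr pF.
have [s E] := commsum_expqD p_pr pchar_quot qE u v.
by apply/subr0_eq; rewrite E big1 // => w _; rewrite mulrC subrr.
Qed.

Let expqB (u v : C0) : (u - v) ^+ q = u ^+ q - v ^+ q.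
Proof. by apply/eqP; rewrite eq_sym subr_eq -expqD subrK. Qed.

(** The q-power map is additive, fixes the scalars from F, and sends generators of either kind to
    generators of the same kind. *)
Lemma coinv_expq s v : V s v -> V s (v ^+ q).
Proof.
move=> [n [a [x [gx ->]]]].
have -> : (\sum_i (pi \o f) (a i) * x i) ^+ q = \sum_i (pi \o f) (a i) * x i ^+ q.
  elim/big_rec2: _ => [|i u w _ <-]; first by rewrite expr0n gtn_eqF // ltnW ?finNzRing_gt1.
  rewrite expqD exprMn; congr (_ * _ + _); have [c /= ->] := f_iota (a i).
  by rewrite -!rmorphXn expf_card.
apply: coinv_sum => i _; apply: coinvZ.
case: (gx i) => [[y [z ->]]|[r [y [rs ->]]]].
  by rewrite exprMn expqB -ractX; apply: coinv_ideal.
by rewrite expqB -ractX; apply: coinv_cent.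
Qed.

(** C0 is finite and reduced, so v is itself an iterated q-th power of v^(q^n), and [coinv_expq]
    applies. *)
Lemma coinv_perfect s v n : V s (v ^+ (q ^ n)) -> V s v.
Proof.
move=> Vv; have [k k_gt0 qE] := finField_card_pchar p_pr pF.
have [d d_gt0 vd] :=
  reduced_perfect quot_inj p_pr pchar_quot qE k_gt0 (Jac_quot_reduced h_inj) v.
rewrite -(vd n) -(prednK d_gt0) mulSn expnD exprM.
elim: (_ * n)%N => [|m IH]; first by rewrite expr1.
by rewrite expnSr exprM; apply: coinv_expq.
Qed.

(* The trace map of the twisted ring attached to the conjugacy class of s: each
   t in the class is moved to s by a chosen conjugating element. *)
Definition class_conj s t : gT := odflt 1%g [pick g | (t ^ g)%g == s].

Definition class_map s (x : A) : C0 :=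
  \sum_(t in (s ^: [set: gT])%g) act0 (pi (x t)) (class_conj s t).

Lemma class_mapD s (x y : A) : class_map s (x + y) = class_map s x + class_map s y.
Proof.
by rewrite -big_split; apply: eq_bigr => t _; rewrite ffunE rmorphD ractD.
Qed.

Lemma class_map0 s : class_map s 0 = 0.
Proof. by rewrite /class_map big1 // => t _; rewrite ffunE rmorph0 ract0. Qed.

Lemma class_mapB s (x y : A) : class_map s (x - y) = class_map s x - class_map s y.
Proof.
by apply/eqP; rewrite eq_sym subr_eq -class_mapD subrK.
Qed.

Lemma class_map_sum s (I : Type) (r : seq I) (P : pred I) (G : I -> A) :
  class_map s (\sum_(i <- r | P i) G i) = \sum_(i <- r | P i) class_map s (G i).
Proof. exact: (big_morph _ (class_mapD s) (class_map0 s)). Qed.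

Lemma class_map_elt s t y : class_map s (elt t y) =
  if t \in (s ^: [set: gT])%g then act0 (pi y) (class_conj s t) else 0.
Proof.
rewrite /class_map; case: ifP => ts.
  rewrite (bigD1 t) // ffunE eqxx big1 => [|u /andP[_ /negPf ut]]; first exact: addr0.
  by rewrite ffunE ut rmorph0 ract0.
rewrite big1 // => u us; rewrite ffunE; case: eqP => [ut|_]; last by rewrite rmorph0 ract0.
by rewrite ut ts in us.
Qed.

(** Two elements conjugating t to s differ by an element of the centralizer of s; the generators y^r
    - y make the choice in [class_conj] immaterial. *)
Lemma class_map_eltJ s t g y : (t ^ g)%g = s ->
  V s (class_map s (elt t y) - act0 (pi y) g).
Proof.
move=> tg; have ts : t \in (s ^: [set: gT])%g.
  by apply/imsetP; exists g^-1%g; rewrite ?finset.in_setT // -tg conjgK.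
rewrite class_map_elt ts /class_conj.
case: pickP => [u /eqP tu|/(_ g)]; last by rewrite tg eqxx.
have -> : act0 (pi y) g = act0 (act0 (pi y) u) (u^-1 * g)%g by rewrite -ractM mulKVg.
rewrite -opprB; apply/coinvN/coinv_cent/cent1P.
have : (u^-1 * g * (t ^ g) = t ^ u * (u^-1 * g))%g by rewrite !conjgE !mulgA !mulgK.
by rewrite tg tu.
Qed.

(* [s y, t z] = (s t)(y^t z) - (t s)(z^s y), and t s is conjugate to s t. *)
Lemma class_map_commsum s (x : A) : commsum x -> V s (class_map s x).
Proof.
move=> [l ->]; rewrite class_map_sum; apply: coinv_sum => -[u v] _ /=.
have -> : u * v - v * u =
    \sum_a \sum_b (elt a (u a) * elt b (v b) - elt b (v b) * elt a (u a)).
  rewrite {1 2}[u]tw_sumE {1 2}[v]tw_sumE mulr_suml [X in _ - X]mulr_sumr -sumrB.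
  by apply: eq_bigr => a _; rewrite mulr_suml mulr_sumr -sumrB.
rewrite class_map_sum; apply: coinv_sum => a _.
rewrite class_map_sum; apply: coinv_sum => b _.
set y := u a; set z := v b; rewrite !tw_eltM class_mapB.
have ba : ((a * b) ^ a)%g = (b * a)%g by rewrite conjgE !mulgA mulVg mul1g.
have [abs|nabs] := boolP ((a * b)%g \in (s ^: [set: gT])%g); last first.
  have /negPf nbas : (b * a)%g \notin (s ^: [set: gT])%g.
    apply: contra nabs => /imsetP[g _ baE]; apply/imsetP; exists (g * a^-1)%g.
      exact: finset.in_setT.
    by rewrite conjgM -baE -ba conjgK.
  by rewrite !class_map_elt (negPf nabs) nbas subrr; apply: coinv0.
have [g abg] : exists g, ((a * b) ^ g)%g = s.
  by case/imsetP: abs => g _ abE; exists g^-1%g; rewrite abE conjgK.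
have bag : ((b * a) ^ (a^-1 * g))%g = s by rewrite -ba -conjgM mulKVg.
have c1 := class_map_eltJ (act y b * z) abg.
have c2 := class_map_eltJ (act z a * y) bag.
(* Moved to s, the two terms are y^(bg) z^g and y^(a^-1 g) z^g. As bg = a^-1 g s, they differ by
   (Q^s - Q) R with Q = y^(a^-1 g) and R = z^g. *)
have := coinvD (coinvB c1 c2) (coinv_ideal s (act0 (pi y) (a^-1 * g)%g) (act0 (pi z) g)).
congr (V s _).
rewrite !piM -!act0E !ractMr -!ractM mulKVg.
have -> : (a^-1 * g * s = b * g)%g.
  by rewrite -abg conjgE !mulgA mulgK mulVg mul1g.
set P := act0 _ (b * g)%g; set Q := act0 _ (a^-1 * g)%g; set R := act0 _ g.
have cancel4 (m1 m2 x1 x2 : C0) : m1 - x1 - (m2 - x2) + (x1 - x2) = m1 - m2.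
  by rewrite opprB addrAC [_ - x1 + _]addrA subrK addrA subrK.
by rewrite mulrBl [R * Q]mulrC; apply: cancel4.
Qed.

(** Modulo the ideal generated by the y^s - y, which V s contains, all conjugates of y under powers
    of s agree. The factor z carries this ideal through the induction. *)
Lemma coinv_prod s y m (z : C0) :
  V s ((pi (\prod_(i < m) act y (s ^+ i)%g) - pi y ^+ m) * z).
Proof.
have one i (u : C0) : V s ((pi (act y (s ^+ i)%g) - pi y) * u).
  elim: i => [|i IH]; first by rewrite expg0 ract1 subrr mul0r; apply: coinv0.
  rewrite -(subrKA (pi (act y (s ^+ i)%g))) mulrDl; apply: coinvD => //.
  by rewrite expgSr ractM -act0E; apply: coinv_ideal.
elim: m z => [|m IH] z.
  by rewrite big_ord0 expr0 rmorph1 subrr mul0r; apply: coinv0.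
rewrite big_ord_recr exprSr piM /=.
set P := pi (\prod_(i < m) _) in IH *; set x := pi (act _ _).
rewrite -(subrKA (pi y ^+ m * x)) mulrDl; apply: coinvD.
  by rewrite -mulrBl -mulrA; apply: IH.
by rewrite -mulrBr [pi y ^+ m * _]mulrC -mulrA; apply: one.
Qed.

(** The origin of both kinds of generators: (y^s - y) z comes from the commutator of y and s z, and
    y^r - y from conjugation by r, which fixes s. *)
Let coinv_gen_lift s v : coinv_gens s v ->
  exists y, pi y = v /\ commsum (elt s y).
Proof.
case=> [[]|[r []]].
  elim/quot_ind => y [z]; elim/quot_ind: z => z ->.
  exists ((act y s - y) * z); split; first by rewrite piM rmorphB act0E.
  have -> : elt s ((act y s - y) * z) = tw_coef act y * elt s z - elt s z * tw_coef act y.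
    by rewrite /tw_coef !tw_eltM mul1g mulg1 ract1 mulrBl raddfB /= [y * z]mulrC.
  exact: commsumC.
elim/quot_ind => y [/cent1P rs ->].
exists (act y r - y); split; first by rewrite rmorphB act0E.
rewrite raddfB /= -opprB; apply: commsumN.
have {2}<- : (s ^ r)%g = s by rewrite conjgE -rs mulKg.
exact: commsum_conj.
Qed.

(** Lifting the generators gives y' with s y' a sum of commutators; y - y' lies in Jac C, so it is
    nilpotent, and so is s (y - y'). *)
Lemma coinv_frobnil s y : V s (pi y) -> frobnil q (elt s y).
Proof.
have [k k_gt0 qE] := finField_card_pchar p_pr pF.
have pA : p%:R = 0 :> A by rewrite -(rmorph_nat (tw_coef act)) pC rmorph0.
move=> [n [a [x [gx yE]]]]; have [x' x'E] := choice (fun i => coinv_gen_lift (gx i)).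
pose y' := \sum_i f (a i) * x' i.
rewrite -(subrK y' y) raddfD /=; apply: (frobnilD p_pr pA qE k_gt0).
  have Jy : Jac C (y - y').
    apply/quot_projP; rewrite yE rmorph_sum; apply: eq_bigr => i _.
    by rewrite /= -(x'E i).1 -piM.
  have [m] := (finite_jacP _ h_inj).1 Jy 1; rewrite mul1r => /(tw_elt_nil act s)[m' ym].
  exact: (frobnil_nilp p_pr qE k_gt0 ym).
apply: frobnil_commsum; rewrite raddf_sum; apply: commsum_sum => i _ /=.
have [c ->] := f_iota (a i); rewrite -tw_coefM //; apply: commsumZ; last exact: (x'E i).2.
by move=> u; apply: tw_coef_central.
Qed.

Variables (Cl : {set gT}) (hCl : p_regular_reps p Cl).

Definition tw_fin (u : A) : {ffun gT -> Y} := [ffun s => h (u s)].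

Lemma tw_fin_inj : injective tw_fin.
Proof.
by move=> u v uv; apply/ffunP => s; have /ffunP/(_ s) := uv; rewrite !ffunE => /h_inj.
Qed.

Let iotaA : {rmorphism F -> A} := tw_coef act \o iota.

Lemma residue_dim_twisted (d : gT -> nat) :
    (forall s, s \in Cl -> residue_dim (pi \o iota) 0 [set: C0]%classic (V s) (d s)) ->
  residue_dim iotaA 0 [set: A]%classic (frobnil q) (\sum_(s in Cl) d s).
Proof.
move=> dV; have [k k_gt0 qE] := finField_card_pchar p_pr pF.
have pA : p%:R = 0 :> A by rewrite -(rmorph_nat (tw_coef act)) pC rmorph0.
have [l l_gt0 regl] := p_regular_expn gT p_pr qE k_gt0.
(* The value 0 outside [Cl] lets the basis be indexed by a dependent pair type over the whole
   group. *)
pose D s := if s \in Cl then d s else 0%N.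
have dV' s : residue_dim (pi \o iota) 0 [set: C0]%classic
    (if s \in Cl then V s else [set: C0]%classic) (D s).
  rewrite /D; case: ifP => [/dV//|_]; exists (fun=> 0); split=> // [x _|a].
    by exists (fun=> 0).
  by split=> // _ [].
pose e0 s := sval (cid (dV' s)).
have [e eE] := choice (fun v : C0 => ex_intro (fun y => pi y = v) _ (quot_reprK v)).
have e0S s (y : C) : s \in Cl -> exists a : 'I_(D s) -> F,
    V s (pi (y - \sum_i iota (a i) * e (e0 s i))).
  move=> sCl; rewrite /e0; case: cid => e1 [/= _ eS _].
  have [a] := eS (pi y) I; rewrite sCl => ay; exists a.
  rewrite rmorphB rmorph_sum /=; congr (V s (_ - _)): ay.
  by apply: eq_bigr => i _; rewrite rmorphM /= eE.
have e0I s (a : 'I_(D s) -> F) : s \in Cl ->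
    V s (pi (\sum_i iota (a i) * e (e0 s i))) -> forall i, a i = 0.
  move=> sCl; rewrite /e0; case: cid => e1 [/= _ _ eI] Va i.
  apply/multiples0/(eI a).1; rewrite sCl; congr (V s _): Va.
  by rewrite rmorph_sum; apply: eq_bigr => j _; rewrite rmorphM /= eE.
pose ix s (i : 'I_(D s)) : {s : gT & 'I_(D s)} := Tagged (fun s => 'I_(D s)) i.
pose E (i : {s : gT & 'I_(D s)}) : A := elt (tag i) (e (e0 _ (tagged i))).
have -> : (\sum_(s in Cl) d s)%N = #|{: {s : gT & 'I_(D s)}}|.
  rewrite card_tagged sumnE big_map big_enum /= big_mkcond.
  by apply: eq_bigr => s _; rewrite card_ord.
have sumE (a : {s : gT & 'I_(D s)} -> F) : \sum_i iotaA (a i) * E i =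
    \sum_(s in Cl) elt s (\sum_(i < D s) iota (a (ix s i)) * e (e0 s i)).
  rewrite (sum_tagged (fun i => iotaA (a i) * E i)) /=.
  rewrite [RHS]big_mkcond; apply: eq_bigr => s _; case: ifP => sCl.
    rewrite raddf_sum; apply: eq_bigr => i _ /=.
    by rewrite /E /= tw_coefM.
  rewrite big1 // => -[i lti] _; exfalso; by rewrite /D sCl in lti.
apply: (@residue_dim_fin _ _ _ _ _ _ _ E) => // [x _|a].
  have [d1 d1_gt0 xd] := frobnil_perfect p_pr pA qE k_gt0 x tw_fin_inj.
  (* A common multiple: x is congruent to x^(q^M) modulo T(A), and all q^M-th powers in the group
     are p-regular. *)
  pose M := (l * d1)%N; have [regM fixM] := regl d1 d1_gt0.
  pose Sp (u : A) := exists a : {s : gT & 'I_(D s)} -> F,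
    frobnil q (u - \sum_i iotaA (a i) * E i).
  have SpD u v : Sp u -> Sp v -> Sp (u + v).
    move=> [a ua] [b vb]; exists (fun i => a i + b i).
    have := frobnilD p_pr pA qE k_gt0 ua vb; congr (frobnil q _).
    rewrite addrACA -opprD -big_split; congr (_ - _); apply: eq_bigr => i _ /=.
    by rewrite !rmorphD mulrDl.
  have Sp_frob u v : frobnil q (u - v) -> Sp v -> Sp u.
    move=> uv [a va]; exists a; have := frobnilD p_pr pA qE k_gt0 uv va.
    by rewrite addrA subrK.
  have Sp0 : Sp 0.
    exists (fun=> 0); rewrite big1 ?subrr; first exact/frobnil_commsum/commsum0.
    by move=> i _; rewrite rmorph0 mul0r.
  have Sp_elt t y : t \in p_regular gT p -> Sp (elt t y).
    case/(p_regular_reps_ex hCl) => s sCl [g tg].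
    apply: (@Sp_frob _ (elt s (act y g))).
      by apply: frobnil_commsum; rewrite -tg; apply: commsum_conj.
    have [a ay] := e0S s (act y g) sCl; set y' := _ - _ in ay.
    pose b (i : {s : gT & 'I_(D s)}) : F := 
      if tag i =P s is ReflectT is_s
      then a (eq_rect _ (fun s => 'I_(D s)) (tagged i) _ is_s) else 0.
    exists b; rewrite sumE (bigD1 s) //= [X in _ - (_ + X)]big1 => [|u /andP[_ us]]; last first.
      rewrite big1 ?raddf0 // => i _; rewrite /b /=; case: eqP => [us'|_].
        by rewrite us' eqxx in us.
      by rewrite rmorph0 mul0r.
    rewrite addr0 -raddfB /=; apply: coinv_frobnil; congr (V s (pi (_ - _))): ay.
    apply: eq_bigr => i _; rewrite /b /=; case: eqP => // ss.
    by rewrite (eq_axiomK ss).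
  apply: (Sp_frob _ _ (xd l)); rewrite [(d1 * l)%N]mulnC.
  apply: (@Sp_frob _ (\sum_s elt s (x s) ^+ (q ^ M))).
    apply: frobnil_commsum; rewrite {1}[x]tw_sumE.
    exact: (commsum_expqn_sum p_pr pA qE k_gt0).
  elim/big_ind: _ => // s _; rewrite tw_eltX; exact: Sp_elt.
split=> [[n xn] [s i]|a0]; last first.
  rewrite big1; first exact/frobnil_commsum/commsum0.
  by move=> i _; have /multiples0 -> := a0 i; rewrite rmorph0 mul0r.
apply/multiples0; have sCl : s \in Cl.
  by apply: contraT => /negPf sCl; case: i => i; rewrite {1}/D sCl.
move: i; apply: (e0I s (fun i => a (ix s i)) sCl).
set y := fun s => \sum_(i < D s) iota (a (ix s i)) * e (e0 s i).
rewrite -/(y s); rewrite sumE -/y in xn.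
(* M is at least n, so the q^M-th power is still a sum of commutators, and it is a positive multiple
   of l, so the elements of [Cl] are fixed by this power. *)
pose M := (l * n.+1)%N; have [regM fixM] := regl n.+1 isT.
have nM : (n <= M)%N by rewrite (leq_trans (leqnSn n)) // leq_pmull.
have {xn}xM := frobnil_leq p_pr pA qE k_gt0 xn nM.
apply: (@coinv_perfect s _ M).
have sM t : t \in Cl -> (t ^+ (q ^ M))%g = t by move/(p_regular_reps_sub hCl)/fixM.
pose P t := \prod_(i < q ^ M) act (y t) (t ^+ i)%g.
have cP : commsum (\sum_(t in Cl) elt t (P t)).
  have := commsum_expqn_sum p_pr pA qE k_gt0 M (enum Cl) (fun t => elt t (y t)).
  rewrite !big_enum /= => /(commsumB xM); rewrite opprB addrC subrK.
  congr (commsum _); apply: eq_bigr => t tCl; by rewrite tw_eltX sM.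
(* Members of [Cl] are pairwise non-conjugate, so only the summand at s survives. Its coefficient
   agrees with the q^M-th power of y s modulo V s, and [coinv_perfect] removes the power. *)
have := class_map_commsum s cP; rewrite class_map_sum (bigD1 s) //= big1 ?addr0; last first.
  move=> t /andP[tCl ts]; rewrite class_map_elt; case: ifP => // /imsetP[g _ tE].
  by rewrite -(p_regular_reps_uniq hCl tCl sCl (esym tE)) eqxx in ts.
have sJ : (s ^ 1)%g = s by rewrite conjg1.
move=> /coinvB/(_ (class_map_eltJ (P s) sJ)); rewrite opprB addrC subrK ract1 => VP.
have := coinvB VP (coinv_prod s (y s) (q ^ M) 1).
by rewrite mulr1 opprB addrC subrK.
Qed.

End Coinvariants.

(** * Discrete valuation rings and integral closure *)

Section DVR.
Variables (S : comPzRingType) (w : S) (hdvr : is_dvr w).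

Lemma dvr_maximal : maximal_left_ideal (multiples w).
Proof. by have [_ _ _ _ /(_ (multiples w))] := hdvr; case=> _; apply. Qed.

Lemma dvr_nonunit : ~ multiples w 1.
Proof. by have [_] := dvr_maximal. Qed.

Lemma dvr_inv a : ~ multiples w a -> exists b, multiples w (1 - b * a).
Proof. exact: maximal_left_ideal_span dvr_maximal. Qed.

Lemma dvr_unit a : exists b, b * (1 + w * a) = 1.
Proof.
apply: contrapT => nb.
have [|M maxM sM] := maximal_left_ideal_exists (multiples_left_ideal (1 + w * a)).
  by case=> b b1; apply: nb; exists b.
have [Ml M1 _] := maxM; have [_ MB _] := Ml; apply: M1.
rewrite -(addrK (w * a) 1); apply: MB; first by apply: sM; exists 1; rewrite mul1r.
have [_ _ _ _ /(_ M) [/(_ maxM) -> _]] := hdvr.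
by exists a; rewrite mulrC.
Qed.

Lemma dvr_residue_field : finite_set [set: quot_ring (principal_ideal w)]%classic ->
  exists (F : finFieldType) (k : {rmorphism S -> F}),
    (forall c, exists s, k s = c) /\ (forall s, k s = 0 <-> multiples w s).
Proof.
move=> fin; pose Q := quot_ring (principal_ideal w).
have Q1 : (1 : Q) != 0.
  apply/eqP; rewrite -(rmorph1 (quot_proj (principal_ideal w))).
  by move=> /quot_proj_eq0/dvr_nonunit.
have Qinv (u : Q) : exists v : Q, u != 0 -> v * u = 1.
  elim/quot_ind: u => a; have [->|aN] := eqVneq (quot_proj _ a) 0; first by exists 0.
  have [|b bE] := @dvr_inv a; first by move=> Ma; case/eqP: aN; apply/quot_proj_eq0.
  exists (quot_proj (principal_ideal w) b) => _.
  rewrite -rmorphM -(rmorph1 (quot_proj (principal_ideal w))).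
  by apply/esym/quot_projP.
have [inv invE] := choice Qinv.
pose inv' u := if u == 0 then 0 else inv u.
have inv'E u : u != 0 -> inv' u * u = 1 by move=> uN; rewrite /inv' (negPf uN) invE.
have inv'0 : inv' 0 = 0 by rewrite /inv' eqxx.
have [s sE] := (finite_seqP _).1 fin.
have s_in (u : Q) : u \in s by have : [set` s]%classic u by rewrite -sE.
have s_pcan : pcancel (fun u : Q => index u s)
    (fun n => if (n < size s)%N then Some (nth 0 s n) else None).
  by move=> u; rewrite index_mem s_in nth_index.
have s_fin : Finite.axiom (undup s).
  by move=> u; rewrite count_uniq_mem ?undup_uniq // mem_undup s_in.
pose Qnz : comNzRingType := HB.pack Q (GRing.PzSemiRing_isNonZero.Build Q Q1).
pose Qf : fieldType := HB.pack Q Qnz (GRing.ComNzRing_isField.Build Qnz inv'E inv'0).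
pose Qc : countType := HB.pack Q (PCanIsCountable s_pcan).
pose QF : finFieldType := HB.pack Q Qf Qc (isFinite.Build Q s_fin).
pose k : {rmorphism S -> QF} := HB.pack (fun x => quot_proj (principal_ideal w) x : QF)
  (GRing.isZmodMorphism.Build S QF _ (@quot_proj_zmod S (principal_ideal w)))
  (GRing.isMonoidMorphism.Build S QF _ (@quot_proj_monoid S (principal_ideal w))).
exists QF, k; split=> [c|x]; first by exists (quot_repr c); apply: quot_reprK.
exact: quot_proj_eq0.
Qed.

End DVR.

(* With W = w x, the relation w^n P(x) = 0 reads sum_i p_i w^(n-i) W^i = 0; modulo
   1 - W its left side is sum_i p_i w^(n-i) = 1 + w (...), a unit. *)
Lemma integral_sub_unit (S T : comPzRingType) (f : {rmorphism S -> T}) (w : S) n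
    (a : 'I_n -> S) (x : T) :
  (forall s, exists b, b * (1 + w * s) = 1) ->
  x ^+ n + \sum_(i < n) f (a i) * x ^+ i = 0 ->
  exists y, (1 - f w * x) * y = 1.
Proof.
move=> units xn; set W := f w * x.
have [b bE] := units (\sum_(i < n) a i * w ^+ (n.-1 - i)).
have geom i : exists r, 1 - W ^+ i = (1 - W) * r.
  exists (\sum_(j < i) W ^+ j); have := subrX1 W i.
  by move/(congr1 -%R); rewrite opprB -mulNr opprB.
have [r0 r0E] := geom n; have [r rE] := choice (fun i : 'I_n => geom i).
have E : f (1 + w * \sum_(i < n) a i * w ^+ (n.-1 - i)) =
    (1 - W) * (r0 + \sum_(i < n) f (a i * w ^+ (n - i)) * r i).
  rewrite mulrDr [in RHS]mulr_sumr -r0E.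
  under [in RHS]eq_bigr do rewrite mulrCA -rE mulrBr mulr1.
  rewrite sumrB addrACA -opprD.
  have -> : W ^+ n + \sum_(i < n) f (a i * w ^+ (n - i)) * W ^+ i = 0.
    transitivity (f w ^+ n * (x ^+ n + \sum_(i < n) f (a i) * x ^+ i)); last by rewrite xn mulr0.
    rewrite mulrDr mulr_sumr exprMn; congr (_ + _); apply: eq_bigr => i _.
    rewrite exprMn rmorphM rmorphXn [RHS]mulrCA -mulrA; congr (_ * _).
    by rewrite mulrA -exprD subnK // ltnW.
  rewrite subr0 rmorphD rmorph1 -rmorph_sum mulr_sumr; congr (_ + f _).
  apply: eq_bigr => i _; rewrite mulrCA -exprS -subSn ?prednK //.
    exact: leq_ltn_trans (ltn_ord i).
  by rewrite -ltnS prednK // (leq_ltn_trans _ (ltn_ord i)).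
exists ((r0 + \sum_(i < n) f (a i * w ^+ (n - i)) * r i) * f b).
by rewrite mulrA -E -rmorphM mulrC bE rmorph1.
Qed.

(** * The uniformizer in the radical of the twisted ring *)

Section TwistedUnit.
Variables (gT : finGroupType) (C : comPzRingType) (act : ringAction gT C) (c : C).
Hypotheses (c_fixed : fixed_by act c) (c_rad : forall x, exists y, (1 - c * x) * y = 1).

Lemma det_sub_scale n (M : 'M[C]_n) : exists x, \det (1%:M - c *: M) = 1 - c * x.
Proof.
pose I := principal_ideal c.
have /quot_projP[x xE] : quot_proj I (\det (1%:M - c *: M)) = quot_proj I 1.
  have cI : quot_proj I c = 0 by apply/quot_proj_eq0; exists 1; rewrite mul1r.
  by rewrite -det_map_mx map_mxB map_mxZ map_mx1 /= cI scale0r subr0 det1 rmorph1.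
by exists (- x); rewrite mulrN opprK [c * x]mulrC -xE [1 + _]addrC subrK.
Qed.

(* Right multiplication of the coefficients by C is linear, so left
   multiplication by an element of the twisted ring is given by a matrix over C. *)
Lemma twisted_right_inverse (u : twisted act) :
  exists v, (1 - tw_coef act c * u) * v = 1.
Proof.
pose M := \matrix_(i < #|gT|, j < #|gT|)
  act (u (enum_val i * (enum_val j)^-1)%g) (enum_val j).
pose U := 1%:M - c *: M; have [x xE] := det_sub_scale M.
have [y yE] := c_rad x.
pose b : 'cV[C]_#|gT| := \col_i ((enum_val i == 1%g)%:R).
pose v' := y *: (\adj U *m b).
have Uv : U *m v' = b.
  by rewrite -scalemxAr mulmxA mul_mx_adj xE mul_scalar_mx scalerA mulrC yE scale1r.
move: v' Uv => v' Uv.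
pose v : twisted act := [ffun s => v' (enum_rank s) 0].
exists v; apply/ffunP => r.
have := congr1 (fun z : 'cV_#|gT| => z (enum_rank r) 0) Uv.
rewrite mulmxBl mul1mx -scalemxAl !mxE enum_rankK => E.
have coefM (z1 z2 : twisted act) s : (z1 * z2) s = \sum_t act (z1 (s * t^-1)%g) t * z2 t.
  by rewrite ffunE.
have subE (z1 z2 : twisted act) s : (z1 - z2) s = z1 s - z2 s by rewrite !ffunE.
rewrite mulrBl mul1r subE -mulrA.
have -> : (tw_coef act c * (u * v)) r = c * (u * v) r.
  rewrite {1}[u * v]tw_sumE mulr_sumr.
  under eq_bigr do rewrite tw_coefM //.
  transitivity ((\sum_s tw_elt act s ([ffun s => c * (u * v) s] s)) r).
    by congr (fun_of_fin _ r); apply: eq_bigr => s _; rewrite ffunE.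
  by rewrite -tw_sumE ffunE.
have -> : (1 : twisted act) r = (r == 1%g)%:R by rewrite ffunE; case: eqP.
have -> : v r = v' (enum_rank r) 0 by rewrite ffunE.
rewrite -E; congr (_ - _ * _); rewrite coefM.
rewrite (reindex_onto (@enum_val _ gT) enum_rank) => [|s _]; last exact: enum_rankK.
apply: eq_big => [j|j _]; first by rewrite enum_valK eqxx.
by rewrite !mxE enum_rankK ffunE enum_valK.
Qed.

(** The right inverse v equals 1 + c u v, hence has the same shape and a right inverse of its own; v
    is thus two-sided. *)
Lemma twisted_left_inverse (u : twisted act) :
  exists v, v * (1 - tw_coef act c * u) = 1.
Proof.
have [v uv] := twisted_right_inverse u; exists v.
have [u' vu'] := twisted_right_inverse (- (u * v)).
have vE : 1 - tw_coef act c * - (u * v) = v.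
  by rewrite mulrN opprK -{1}uv mulrBl mul1r -mulrA subrK.
rewrite vE in vu'.
have -> : 1 - tw_coef act c * u = u'.
  transitivity ((1 - tw_coef act c * u) * (v * u')); first by rewrite vu' mulr1.
  by rewrite mulrA uv mul1r.
by [].
Qed.

Lemma tw_coef_maximal (M : set (twisted act)) : maximal_left_ideal M -> M (tw_coef act c).
Proof.
move=> maxM; apply: contrapT => nMc; have [[_ _ MM] M1 _] := maxM.
have [a Ma] := maximal_left_ideal_span maxM nMc; apply: M1.
have [v vE] := twisted_left_inverse a.
rewrite -vE; apply: MM; by rewrite tw_coef_central.
Qed.

End TwistedUnit.

(** Since the kernel lies in every maximal left ideal, images and preimages under h match the
    maximal left ideals of A and B. *)
Lemma Jac_morph (A B : pzRingType) (h : {rmorphism A -> B}) :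
  (forall y, exists x, h x = y) ->
  (forall (M : set A) x, maximal_left_ideal M -> h x = 0 -> M x) ->
  forall x, Jac A x <-> Jac B (h x).
Proof.
move=> h_surj h_ker x.
have pre (I : set B) : left_ideal I -> left_ideal (fun x => I (h x)).
  move=> [I0 IB IM]; split=> [|y z Iy Iz|a y Iy]; rewrite ?rmorph0 ?rmorphB ?rmorphM //.
    exact: IB.
  exact: IM.
have img (I : set A) : left_ideal I -> left_ideal (fun y => exists2 x, I x & h x = y).
  move=> [I0 IB IM]; split=> [|_ _ [y Iy <-] [z Iz <-]|b _ [y Iy <-]].
  - by exists 0; rewrite ?rmorph0.
  - by exists (y - z); rewrite ?rmorphB //; apply: IB.
  - by have [a <-] := h_surj b; exists (a * y); rewrite ?rmorphM //; apply: IM.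
have sat (M : set A) z : maximal_left_ideal M -> (exists2 x, M x & h x = h z) -> M z.
  move=> maxM [y My yz]; rewrite -(subrK y z); apply: left_idealD (My); first by case: maxM.
  by apply: h_ker maxM _; rewrite rmorphB yz subrr.
split=> [Jx M [Ml M1 Mmax]|Jx M maxM].
  apply: (Jx (fun x => M (h x))); split; [exact: pre | by rewrite rmorph1 |].
  move=> N Nl MN N1; apply/seteqP; split=> [z Nz|]; last exact: MN.
  have maxN : forall z, (exists2 x, N x & h x = h z) -> N z.
    move=> z' [y Ny yz]; rewrite -(subrK y z'); apply: left_idealD => //.
    by apply: MN; rewrite rmorphB yz subrr; have [] := Ml.
  rewrite -(Mmax _ (img N Nl)); first by exists z.
    by move=> y My; have [x' x'y] := h_surj y; exists x' => //; apply: MN; rewrite x'y.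
  by move=> [y Ny y1]; apply: N1; apply: maxN; exists y; rewrite ?rmorph1.
apply: (sat _ _ maxM); have [Ml M1 Mmax] := maxM.
apply: (Jx (fun y => exists2 x, M x & h x = y)); split; first exact: img.
  by move=> [y My y1]; apply: M1; apply: (sat _ _ maxM); exists y; rewrite ?rmorph1.
move=> N Nl MN N1; apply/seteqP; split=> [y Ny|]; last exact: MN.
have [x' x'y] := h_surj y; exists x' => //.
rewrite -(Mmax (fun x => N (h x))); [by rewrite x'y | exact: pre | | by rewrite rmorph1].
by move=> z Mz; apply: MN; exists z.
Qed.

(* Artin: a nontrivial relation sum_i v_i (e_i)^s = 0 (for all s) of minimal
   support, normalized to have a coefficient 1, has fixed coefficients. *)
Lemma artin_dependence (gT : finGroupType) (L : fieldType) (act : ringAction gT L)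
    n (e : 'I_n -> L) : (#|gT| < n)%N ->
  exists c : 'I_n -> L, [/\ forall i, fixed_by act (c i), exists i, c i != 0
    & \sum_i c i * e i = 0].
Proof.
move=> ltn; pose Sol (v : 'I_n -> L) := (exists i, v i != 0) /\
  forall s, \sum_i v i * act (e i) s = 0.
pose supp (v : 'I_n -> L) := #|[pred i | v i != 0]|.
pose P k := `[< exists v, Sol v /\ supp v = k >].
have exP : exists k, P k.
  pose M := \matrix_(i < n, j < #|gT|) act (e i) (enum_val j).
  have : kermx M != 0.
    by rewrite kermx_eq0 -row_leq_rank -ltnNge (leq_ltn_trans (rank_leq_col M)).
  case/rowV0Pn => v /sub_kermxP vM vN0.
  exists (supp (v 0)); apply/asboolP; exists (v 0); split=> //; split=> [|s].
    by case/rV0Pn: vN0 => i vi; exists i.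
  have := congr1 (fun z : 'rV_#|gT| => z 0 (enum_rank s)) vM; rewrite !mxE => E.
  by rewrite -[RHS]E; apply: eq_bigr => i _; rewrite mxE enum_rankK.
case: (ex_minnP exP) => k /asboolP[v [[[i0 vi0] vS] <-]] vmin.
pose u i := v i / v i0.
have uS s : \sum_i u i * act (e i) s = 0.
  rewrite -[RHS](mul0r (v i0)^-1) -[in RHS](vS s) mulr_suml.
  by apply: eq_bigr => i _; rewrite mulrAC.
exists u; split=> [i s||]; last first.
- by rewrite -[RHS](uS 1%g); apply: eq_bigr => i _; rewrite ract1.
- by exists i0; rewrite mulf_neq0 ?invr_eq0.
apply: contrapT => /eqP; rewrite -subr_eq0 => di.
pose d i := act (u i) s - u i.
have dS : Sol d.
  split; first by exists i.
  move=> t; under eq_bigr do rewrite mulrBl; rewrite sumrB uS subr0.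
  rewrite -[RHS](ract0 act s) -[in RHS](uS (t * s^-1)%g) ract_sum.
  by apply: eq_bigr => j _; rewrite [RHS]ractMr -ractM mulgKV.
have /vmin : P (supp d) by apply/asboolP; exists d.
rewrite leqNgt => /negP; apply; apply: proper_card; apply/properP; split.
  apply/fintype.subsetP => j; rewrite !inE; apply: contra => /eqP vj.
  by rewrite /d /u vj mul0r ract0 subrr.
exists i0; rewrite !inE // negbK /d /u divff // ract1r subrr //.
Qed.

Lemma rmorph_factor (S T : comPzRingType) (A : pzRingType) (w : S)
    (k : {rmorphism S -> T}) (f : {rmorphism S -> A}) :
  (forall t, exists s, k s = t) -> (forall s, k s = 0 <-> multiples w s) -> f w = 0 ->
  exists g : {rmorphism T -> A}, forall s, g (k s) = f s.
Proof.
move=> k_surj kw fw; have [r rK] := choice k_surj.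
have fk a b : k a = k b -> f a = f b.
  move=> kab; have [|c cE] := (kw (a - b)).1; first by rewrite rmorphB kab subrr.
  by apply/subr0_eq; rewrite -rmorphB cE rmorphM fw mulr0.
pose g t := f (r t).
have gB : zmod_morphism g by move=> x y; rewrite /g -rmorphB; apply: fk; rewrite rmorphB !rK.
have gM : monoid_morphism g.
  split=> [|x y]; first by rewrite /g -(rmorph1 f); apply: fk; rewrite rK rmorph1.
  by rewrite /g -rmorphM; apply: fk; rewrite rmorphM !rK.
pose gR : {rmorphism T -> A} := HB.pack g
  (GRing.isZmodMorphism.Build T A g gB) (GRing.isMonoidMorphism.Build T A g gM).
by exists gR; move=> s; apply: fk; rewrite rK.
Qed.

Section TwistedMorph.
Variables (gT : finGroupType) (C : comPzRingType) (act : ringAction gT C).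
Variables (I : twosided C) (Istab : forall x s, I x -> I (act x s)).

Definition tw_quot (u : twisted act) : twisted (quot_act Istab) :=
  [ffun s => quot_proj I (u s)].

Lemma tw_quot_zmod : zmod_morphism tw_quot.
Proof. by move=> u v; apply/ffunP => s; rewrite !ffunE rmorphB. Qed.

Lemma tw_quot_monoid : monoid_morphism tw_quot.
Proof.
split=> [|u v]; apply/ffunP => s; rewrite !ffunE.
  by case: eqP; rewrite ?rmorph0 ?rmorph1.
rewrite rmorph_sum; apply: eq_bigr => t _.
by rewrite rmorphM !ffunE; congr (_ * _); apply/esym/quot_act_funE.
Qed.

HB.instance Definition _ := GRing.isZmodMorphism.Build _ _ tw_quot tw_quot_zmod.
HB.instance Definition _ := GRing.isMonoidMorphism.Build _ _ tw_quot tw_quot_monoid.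

Lemma tw_quot_surj v : exists u, tw_quot u = v.
Proof. by exists [ffun s => quot_repr (v s)]; apply/ffunP => s; rewrite !ffunE quot_reprK. Qed.

Lemma tw_quot_elt s y : tw_quot (tw_elt act s y) = tw_elt (quot_act Istab) s (quot_proj I y).
Proof. by apply/ffunP => t; rewrite !ffunE; case: eqP; rewrite ?rmorph0. Qed.

End TwistedMorph.

Lemma center_mod_jac_morph (A B : pzRingType) (h : {rmorphism A -> B}) :
  (forall y, exists x, h x = y) -> (forall x, Jac A x <-> Jac B (h x)) ->
  forall x, center_mod_jac x <-> center_mod_jac (h x).
Proof.
move=> h_surj hJ x; split=> [cx y|cx y]; last by apply/hJ; rewrite rmorphB !rmorphM.
by have [z <-] := h_surj y; rewrite -!rmorphM -rmorphB; apply/hJ.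
Qed.

Lemma residue_dim_center_quot (S : comPzRingType) (A : pzRingType) (w : S)
    (f : {rmorphism S -> A}) n :
  residue_dim f w (@center_mod_jac A) (Jac A) n <->
  residue_dim (quot_proj (Jac A) \o f) w (center (quot_ring (Jac A))) [set 0]%classic n.
Proof.
apply: (@residue_dim_morph _ _ _ _ _ _ (quot_proj (Jac A))) => //.
- by elim/quot_ind => x; exists x.
- by move=> x; apply: center_mod_jacP.
- by move=> x; apply: iff_sym; apply: quot_proj_eq0.
Qed.

(** * Relations over the base ring and finiteness of T/wT *)

Section IntegralClosureBound.
Variables (gT : finGroupType) (L : fieldType) (act : ringAction gT L) (S : subringClosed L).
Hypothesis hK : forall x : L, fixed_by act x ->
       exists a b : sub_ring S, b != 0 /\ x = val a / val b.
Variables (w : sub_ring S) (hdvr : is_dvr w).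

(** Denominators of Artin's fixed coefficients are cleared, and the results are divided by a
    generator d of the ideal they span. The quotients g i then generate the unit ideal, so the
    relation stays nontrivial modulo w. *)
Lemma primitive_relation n (e : 'I_n -> intT S) : (#|gT| < n)%N ->
  exists g : 'I_n -> sub_ring S, (exists i, ~ multiples w (g i)) /\
    \sum_i base_to_T (g i) * e i = 0.
Proof.
move=> ltn; have [c [cF [i0 ci0] cE]] := artin_dependence act (fun i => val (e i)) ltn.
have [ab abE] := choice (fun i => hK (cF i)).
have [b bE] := choice abE.
pose C i := ab i * \prod_(j | j != i) b j.
pose vl : {rmorphism sub_ring S -> L} := val.
have CE i : vl (C i) = c i * vl (\prod_j b j).
  have [bi ->] := bE i; rewrite (bigD1 i) // /C !rmorphM mulrA divfK //.
pose I : set (sub_ring S) :=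
  [set x | exists a : 'I_n -> sub_ring S, x = \sum_i a i * C i]%classic.
have Il : left_ideal I.
  split=> [|_ _ [a1 ->] [a2 ->]|a _ [a1 ->]].
  - by exists (fun=> 0); rewrite big1 // => i _; rewrite mul0r.
  - by exists (fun i => a1 i - a2 i); rewrite -sumrB; apply: eq_bigr => i _; rewrite mulrBl.
  - by exists (fun i => a * a1 i); rewrite mulr_sumr; apply: eq_bigr => i _; rewrite mulrA.
have [_ _ /(_ I Il)[d dE] _ _] := hdvr.
have [a aE] : I d by rewrite dE; exists 1; rewrite mul1r.
have CI i : multiples d (C i).
  rewrite -dE; exists (fun j => (j == i)%:R); rewrite (bigD1 i) //= eqxx mul1r big1 ?addr0 //.
  by move=> j /negPf ji; rewrite ji mul0r.
have [g gE] := choice CI.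
have dN0 : vl d != 0.
  apply: contraNneq ci0 => d0; have := CE i0.
  rewrite gE rmorphM d0 mulr0 => /esym/eqP; rewrite mulf_eq0 => /orP[//|].
  rewrite rmorph_prod => /prodf_eq0[j _]; have [bj _] := bE j.
  by rewrite -(inj_eq val_inj) in bj; rewrite (negPf bj).
exists g; split.
  apply: contrapT => ng; apply: (dvr_nonunit hdvr).
  have gw i : multiples w (g i) by apply: contrapT => ni; apply: ng; exists i.
  have -> : 1 = \sum_i a i * g i.
    apply: val_inj; apply: (mulIf dN0); rewrite -[LHS](rmorphM vl) -[RHS](rmorphM vl) mul1r.
    congr (vl _); rewrite mulr_suml {1}aE; apply: eq_bigr => i _.
    by rewrite -mulrA -gE.
  have [h hE] := choice gw; exists (\sum_i a i * h i); rewrite mulr_suml.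
  by apply: eq_bigr => i _; rewrite -mulrA -hE.
pose vT : {rmorphism intT S -> L} := val.
have vTb x : vT (base_to_T x) = vl x by [].
apply: val_inj; apply: (mulIf dN0); rewrite -/vT rmorph0 mul0r.
rewrite -[val _]/(vT _) rmorph_sum mulr_suml.
rewrite -[RHS](mul0r (vl (\prod_j b j))) -[in RHS]cE mulr_suml.
apply: eq_bigr => i _; rewrite rmorphM vTb [RHS]mulrAC -CE gE rmorphM.
by rewrite mulrAC.
Qed.

Lemma integral_unit (x : intT S) : exists y, (1 - base_to_T w * x) * y = 1.
Proof.
have [P monP Px] := int_closureP _ _ (valP x).
have [n nE] : exists n, size P = n.+1.
  by exists (size P).-1; rewrite prednK // lt0n size_poly_eq0 monic_neq0.
apply: (@integral_sub_unit _ _ (@base_to_T L S) w n (fun i => P`_i)).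
  exact: dvr_unit hdvr.
pose vl : {rmorphism sub_ring S -> L} := val.
pose vT : {rmorphism intT S -> L} := val.
have Pn : P`_n = 1 by rewrite -[n]/(n.+1.-1) -nE; apply/eqP.
have sP : (size (map_poly vl P) <= n.+1)%N by rewrite -nE; apply: size_poly.
have cn : (map_poly vl P)`_n = 1 by rewrite coef_map Pn; apply: (rmorph1 vl).
have := rootP Px; rewrite (horner_coef_wide _ sP) big_ord_recr cn mul1r addrC.
move=> PE; apply: val_inj; apply: etrans PE.
rewrite -[LHS]/(vT _) rmorphD rmorphXn rmorph_sum; congr (_ + _); apply: eq_bigr => i _.
by rewrite rmorphM rmorphXn coef_map.
Qed.

End IntegralClosureBound.

Theorem theorem3p14 (gT : finGroupType) (L : fieldType) (act : ringAction gT L)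
    (S : subringClosed L)
    (hSK : forall x : L, x \in S -> fixed_by act x)
    (hK : forall x : L, fixed_by act x <->
       exists a b : sub_ring S, b != 0 /\ x = val a / val b)
    (w : sub_ring S) (hdvr : is_dvr w)
    (hfin : finite_set [set: Sbar w]%classic)
    (p : nat) (hp : prime p) (hchar : p%:R = 0 :> Sbar w)
    (Cl : {set gT}) (hCl : p_regular_reps p Cl) :
  exists d : gT -> nat,
    [/\ forall s, s \in Cl ->
          residue_dim (base_to_Tbar0 w) w [set: Tbar0 w]%classic
            (V_space hSK w s) (d s),
        residue_dim (base_to_LamJ hSK) w
          (center (LamJ hSK)) [set 0]%classic
          (\sum_(s in Cl) d s)%N
      & residue_dim (base_to_LambarJ hSK w) w
          (center (LambarJ hSK w)) [set 0]%classic
          (\sum_(s in Cl) d s)%N].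
Proof.
have [F [k [k_surj kw]]] := dvr_residue_field hdvr hfin.
have pF : p%:R = 0 :> F.
  rewrite -(rmorph_nat k); apply/kw/(quot_proj_eq0 (principal_ideal w)).
  by rewrite rmorph_nat.
have f_w : base_to_Tbar w w = 0.
  by apply/quot_proj_eq0; exists 1; rewrite mul1r.
have [iota iotaE] := rmorph_factor k_surj kw f_w.
have f_iota a : exists c, base_to_Tbar w a = iota c by exists (k a).
have iota_f c : exists a, base_to_Tbar w a = iota c.
  by have [a <-] := k_surj c; exists a.
pose aT := actTbar hSK w.
have f_fixed a : fixed_by aT (base_to_Tbar w a).
  move=> s; rewrite [LHS](quot_act_funE (multiples_stable (base_to_T_fixed hSK w))).
  by congr quot_proj; apply: base_to_T_fixed.
have iota_fixed c : fixed_by aT (iota c) by have [a <-] := iota_f c.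
(* More than |G| elements of T/wT are dependent, by a primitive relation between lifts. The
   coordinates then inject T/wT into a finite space of row vectors. *)
have [N /residue_dim_coordinates[vec [unvec [_ vecK _]]]] :
    exists N, residue_dim iota 0 [set: Tbar w]%classic [set 0]%classic N.
  apply: (@residue_dim_exists _ _ _ _ _ _ #|gT|) => //.
  - by move=> c x ->; rewrite mulr0.
  move=> n e _ eI; rewrite leqNgt; apply/negP => ltn.
  have [g [[i gi] gE]] :=
    primitive_relation (fun x => (hK x).1) hdvr (fun i => quot_repr (e i)) ltn.
  apply: gi; apply/kw; apply: (eI (fun i => k (g i))).
  rewrite /=; transitivity (quot_proj (principal_ideal (base_to_T w))
      (\sum_j base_to_T (g j) * quot_repr (e j))); last by rewrite gE rmorph0.
  rewrite rmorph_sum.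
  apply: eq_bigr => j _; rewrite iotaE rmorphM; congr (_ * _).
  by apply/esym/quot_reprK.
have vec_inj := can_inj vecK.
pose V s := coinv_space aT (base_to_Tbar w) s.
pose iota0 : {rmorphism F -> Tbar0 w} := quot_proj (Jac (Tbar w)) \o iota.
have [d dE] : exists d : gT -> nat, forall s,
    residue_dim iota0 0 [set: Tbar0 w]%classic (V s) (d s).
  have [s|d dE] := @choice _ _
    (fun s n => residue_dim iota0 0 [set: Tbar0 w]%classic (V s) n); last by exists d.
  apply: (@residue_dim_exists_finite _ _ _ _ _ _ _ (vec \o @quot_repr _ (Jac (Tbar w)))).
  - by move=> c x; have [a aE] := iota_f c; rewrite /iota0 /= -aE; apply: coinvZ.
  - by apply: (inj_comp vec_inj); apply: can_inj (@quot_reprK _ _).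
  - exact: coinv0.
exists d.
have LbarE : residue_dim (tw_coef aT \o base_to_Tbar w) w
    (@center_mod_jac (Lambar hSK w)) (Jac (Lambar hSK w)) (\sum_(s in Cl) d s).
  have [N' A_dim] : exists N', residue_dim (tw_coef aT \o iota) 0
      [set: Lambar hSK w]%classic [set 0]%classic N'.
    apply: (@residue_dim_exists_finite _ _ _ _ _ _ _ (@tw_fin _ _ aT _ vec)) => //.
    - by move=> c x ->; rewrite mulr0.
    - exact: tw_fin_inj.
  have gk s : (tw_coef aT \o iota) (k s) = (tw_coef aT \o base_to_Tbar w) s by rewrite /= iotaE.
  apply: (@residue_dim_base _ _ _ w k _ _ _ _ _ k_surj kw gk).1.
  apply: (residue_dim_center_mod_jac hp pF _ A_dim).
    by move=> c x; apply: tw_coef_central.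
  by apply: (residue_dim_twisted iota_fixed hp pF vec_inj f_iota hCl) => s _.
split.
- have gk a : iota0 (k a) = base_to_Tbar0 w a by rewrite /= iotaE.
  by move=> s _; apply: ((@residue_dim_base _ _ _ w k _ _ _ _ _ k_surj kw gk).1 (dE s)).
- apply: (@residue_dim_center_quot _ (Lam hSK) w (tw_coef (actT hSK) \o @base_to_T L S) _).1.
  pose h : {rmorphism Lam hSK -> Lambar hSK w} :=
    tw_quot (multiples_stable (base_to_T_fixed hSK w)).
  have h_surj y : exists x, h x = y by apply: tw_quot_surj.
  (* An element of the kernel of h has all its coefficients divisible by w, so it is a left multiple
     of w, which lies in every maximal left ideal. *)
  have hJ : forall x, Jac (Lam hSK) x <-> Jac (Lambar hSK w) (h x).
    apply: Jac_morph => // M x maxM /ffunP hx.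
    have Mw : M (tw_coef (actT hSK) (base_to_T w)).
      by apply: tw_coef_maximal maxM; [apply: base_to_T_fixed | apply: integral_unit].
    have xw s : exists b, x s = b * base_to_T w.
      by apply/(quot_proj_eq0 (principal_ideal (base_to_T w))); have := hx s; rewrite !ffunE.
    have [b bE] := choice xw.
    pose b' : twisted (actT hSK) := [ffun s => b s].
    have -> : x = b' * tw_coef (actT hSK) (base_to_T w).
      rewrite [LHS](@tw_sumE _ _ (actT hSK) x) [b']tw_sumE mulr_suml; apply: eq_bigr => s _.
      by rewrite /tw_coef tw_eltM mulg1 ract1 ffunE bE.
    by have [[_ _ MM] _ _] := maxM; apply: MM.
  apply: (@residue_dim_morph _ _ _ w _ (tw_coef aT \o base_to_Tbar w) h _ _
     (@center_mod_jac (Lambar hSK w)) (Jac (Lambar hSK w)) _ h_surj _ _ hJ).2 LbarE.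
    by move=> s; apply: tw_quot_elt.
  exact: center_mod_jac_morph.
exact: (@residue_dim_center_quot _ (Lambar hSK w) w (tw_coef aT \o base_to_Tbar w) _).1.
Qed.
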